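(* Consider an LBDD setting with a fixed set of $k$ service centers (with their capacities and penalty functions) and a set of demand units that grows by insertions, where an allotment inducing no negative cost loop is maintained. When a new demand unit (together with its costs $\mathcal{CM}(\cdot,s_x)$ to all $k$ service centers) is added to an instance currently having $n$ demand units, an allotment of the enlarged instance that induces no negative cost loop can be obtained in time $O(k^3+k^2\log n)$.
   Context: An instance of the Load Balanced Demand Distribution (LBDD) problem consists of: a finite set $S=\{s_1,\dots,s_k\}$ of service centers; a finite set $D$ of demand units; a cost matrix $\mathcal{CM}$ giving a positive integer $\mathcal{CM}(d,s)$ for every pair $(d,s)\in D\times S$; for each $s_i$ a positive integer capacity $c_i$; and for each $s_i$ a penalty function $q_i$ on the positive integers, where $q_i(m)$ is the extra cost incurred by the $m$-th demand unit assigned to $s_i$: $q_i(m)=0$ for $m\le c_i$, and for $m>c_i$ the values $q_i(m)$ are positive and monotonically increasing in $m$ (convention $q_i(0)=0$). An allotment $\mathcal{A}$ assigns every demand unit to exactly one service center; $o_i=o_i(\mathcal{A})$ denotes the number of demand units assigned to $s_i$. Cost entries and penalty values can be accessed, and arithmetic performed, in constant time. The allotment subspace multigraph $\Gamma(\mathcal{A})$ has vertex set $S$ and, for each demand unit $dn$ assigned to $s_i$ and each $s_j\neq s_i$, a directed transfer edge $(s_i,s_j,dn)$ of cost $\mathcal{CM}(dn,s_j)-\mathcal{CM}(dn,s_i)$. The penalty transfer edge from $s_x$ to $s_y$ ($x\ne y$) has weight $q_x(o_x+1)-q_y(o_y)$. A loop induced by $\mathcal{A}$ from $s_a$ to $s_b$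 ($s_a\neq s_b$) consists of a directed path $P$ in $\Gamma(\mathcal{A})$ from $s_a$ to $s_b$ with pairwise distinct vertices, closed either (i) by a transfer edge of $\Gamma(\mathcal{A})$ from $s_b$ to $s_a$, the loop's cost being the sum of the costs of its transfer edges; or (ii) by the penalty transfer edge from $s_b$ to $s_a$, the loop's cost being the sum of the costs of the edges of $P$ plus $q_b(o_b+1)-q_a(o_a)$. A negative cost loop is a loop of cost less than zero. *)

(* Defs.v *)
From mathcomp Require Import all_boot all_order all_algebra.
Set Implicit Arguments.
Unset Strict Implicit.
Unset Printing Implicit Defensive.
Import Order.TTheory GRing.Theory Num.Theory.
Local Open Scope ring_scope.

(* An instance is split into the part that never changes ([centers]) and the
   part that grows ([demand]).  The set S of service centers is 'I_k; the
   demand units are numbered 0, ..., n-1 by order of arrival.  Penalties take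
   values in an arbitrary totally ordered integral domain (integers, rationals,
   reals, ...) and need only be nondecreasing beyond the capacity. *)

Record centers (R : realDomainType) (k : nat) := Centers {
  capacity : 'I_k -> nat;
  penalty : 'I_k -> nat -> R;
  capacity_gt0 : forall i, (0 < capacity i)%N;
  penalty_eq0 : forall i m, (m <= capacity i)%N -> penalty i m = 0;
  penalty_gt0 : forall i m, (capacity i < m)%N -> 0 < penalty i m;
  penalty_mono : forall i m m',
    (capacity i < m)%N -> (m <= m')%N -> penalty i m <= penalty i m' }.

Record demand (k n : nat) := Demand {
  cm :> 'I_n -> 'I_k -> nat;
  cm_gt0 : forall d i, (0 < cm d i)%N }.

(* D' is D together with one new unit, whose number is n. *)
Definition extends k n (D' : demand k n.+1) (D : demand k n) : Prop :=
  forall d i, D' (widen_ord (leqnSn n) d) i = D d i.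

Notation allotment k n := {ffun 'I_n -> 'I_k}.

Definition load k n (A : allotment k n) (i : 'I_k) : nat :=
  #|[set d | A d == i]|.

Section Loops.
Variables (R : realDomainType) (k n : nat).
Variables (sc : centers R k) (D : demand k n) (A : allotment k n).

Record edge := Edge { src : 'I_k; dst : 'I_k; unit_of : 'I_n }.

Definition transfer_edge (e : edge) : bool :=
  (A (unit_of e) == src e) && (dst e != src e).

Definition edge_cost (e : edge) : R :=
  (D (unit_of e) (dst e))%:R - (D (unit_of e) (src e))%:R.

Definition penalty_edge_cost (x y : 'I_k) : R :=
  penalty sc x (load A x).+1 - penalty sc y (load A y).

Fixpoint walk (a : 'I_k) (p : seq edge) (b : 'I_k) : bool :=
  if p is e :: p' then
    [&& transfer_edge e, src e == a & walk (dst e) p' b]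
  else a == b.

Definition simple_path (a : 'I_k) (p : seq edge) (b : 'I_k) : bool :=
  walk a p b && uniq (a :: map dst p).

Inductive induced_loop : R -> Prop :=
| TransferLoop a b p e :
    a != b -> simple_path a p b ->
    transfer_edge e -> src e = b -> dst e = a ->
    induced_loop (\sum_(f <- p) edge_cost f + edge_cost e)
| PenaltyLoop a b p :
    a != b -> simple_path a p b ->
    induced_loop (\sum_(f <- p) edge_cost f + penalty_edge_cost b a).

Definition has_negative_loop : Prop := exists2 c, induced_loop c & c < 0.

End Loops.

(* The model of computation: a unit-cost random access machine, presented as
   a language of while programs over one-dimensional arrays.  There are two
   sorts of data: natural numbers (counters, indices, addresses) and values
   in R (costs and penalties).  Programs are finite and contain no data from
   the instance, which they can only read one entry at a time.  Each arithmetic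
   operation, comparison, memory access or instance access takes one time
   unit.  Subtraction on nat is truncated, and there is no division. *)

Inductive aop := Add | Sub | Mul.

Inductive nexp :=
| NConst of nat
| NLoad of nat & nexp            (* array name, index *)
| NOp of aop & nexp & nexp
| NCenters                       (* k *)
| NUnits                         (* n *)
| NCapacity of nexp.

Inductive vexp :=
| VConst of nat
| VLoad of nat & nexp
| VOp of aop & vexp & vexp
| VCost of nexp & nexp           (* demand unit, service center *)
| VPenalty of nexp & nexp.       (* service center, position m *)

Inductive bexp :=
| NLe of nexp & nexp
| VLe of vexp & vexp
| BNot of bexp
| BAnd of bexp & bexp.

Inductive cmd :=
| Skip
| NStore of nat & nexp & nexp    (* array name, index, stored value *)
| VStore of nat & nexp & vexp
| Seq of cmd & cmd
| If of bexp & cmd & cmd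
| While of bexp & cmd.

Fixpoint ntime (e : nexp) : nat :=
  match e with
  | NConst _ | NCenters | NUnits => 1
  | NLoad _ e1 | NCapacity e1 => (ntime e1).+1
  | NOp _ e1 e2 => (ntime e1 + ntime e2).+1
  end.

Fixpoint vtime (e : vexp) : nat :=
  match e with
  | VConst _ => 1
  | VLoad _ e1 => (ntime e1).+1
  | VOp _ e1 e2 => (vtime e1 + vtime e2).+1
  | VCost e1 e2 | VPenalty e1 e2 => (ntime e1 + ntime e2).+1
  end.

Fixpoint btime (b : bexp) : nat :=
  match b with
  | NLe e1 e2 => (ntime e1 + ntime e2).+1
  | VLe e1 e2 => (vtime e1 + vtime e2).+1
  | BNot b1 => (btime b1).+1
  | BAnd b1 b2 => (btime b1 + btime b2).+1
  end.

(* nmem s a x is cell x of the nat array named a, and vmem likewise for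
   values.  Arrays are unbounded. *)
Record state (R : realDomainType) := State {
  nmem : nat -> nat -> nat;
  vmem : nat -> nat -> R }.

Definition update T (m : nat -> nat -> T) (a x : nat) (v : T) :
    nat -> nat -> T :=
  fun a' x' => if (a' == a) && (x' == x) then v else m a' x'.

Section Semantics.
Variables (R : realDomainType) (k n : nat).
Variables (sc : centers R k) (D : demand k n).

(* Reading outside the current instance yields 0; in particular the costs of
   units that have not arrived yet are not accessible. *)
Definition read_capacity (i : nat) : nat :=
  if insub i is Some i' then capacity sc i' else 0%N.

Definition read_cost (d i : nat) : R :=
  if (insub d, insub i) is (Some d', Some i') then (D d' i')%:R else 0.

Definition read_penalty (i m : nat) : R :=
  if insub i is Some i' then penalty sc i' m else 0.

Definition nop (o : aop) : nat -> nat -> nat :=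
  match o with Add => addn | Sub => subn | Mul => muln end.

Definition vop (o : aop) (x y : R) : R :=
  match o with Add => x + y | Sub => x - y | Mul => x * y end.

Fixpoint neval (s : state R) (e : nexp) : nat :=
  match e with
  | NConst c => c
  | NLoad a e1 => nmem s a (neval s e1)
  | NOp o e1 e2 => nop o (neval s e1) (neval s e2)
  | NCenters => k
  | NUnits => n
  | NCapacity e1 => read_capacity (neval s e1)
  end.

Fixpoint veval (s : state R) (e : vexp) : R :=
  match e with
  | VConst c => c%:R
  | VLoad a e1 => vmem s a (neval s e1)
  | VOp o e1 e2 => vop o (veval s e1) (veval s e2)
  | VCost e1 e2 => read_cost (neval s e1) (neval s e2)
  | VPenalty e1 e2 => read_penalty (neval s e1) (neval s e2)
  end.

Fixpoint beval (s : state R) (b : bexp) : bool :=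
  match b with
  | NLe e1 e2 => (neval s e1 <= neval s e2)%N
  | VLe e1 e2 => veval s e1 <= veval s e2
  | BNot b1 => ~~ beval s b1
  | BAnd b1 b2 => beval s b1 && beval s b2
  end.

(* exec c s t s': started in s, c halts after t time units in s'. *)
Inductive exec : cmd -> state R -> nat -> state R -> Prop :=
| ESkip s : exec Skip s 1 s
| ENStore s a e1 e2 :
    exec (NStore a e1 e2) s (ntime e1 + ntime e2).+1
      (State (update (nmem s) a (neval s e1) (neval s e2)) (vmem s))
| EVStore s a e1 e2 :
    exec (VStore a e1 e2) s (ntime e1 + vtime e2).+1
      (State (nmem s) (update (vmem s) a (neval s e1) (veval s e2)))
| ESeq c1 c2 s s1 s2 t1 t2 :
    exec c1 s t1 s1 -> exec c2 s1 t2 s2 ->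
    exec (Seq c1 c2) s (t1 + t2).+1 s2
| EIfTrue b c1 c2 s s1 t1 :
    beval s b -> exec c1 s t1 s1 ->
    exec (If b c1 c2) s (btime b + t1).+1 s1
| EIfFalse b c1 c2 s s1 t1 :
    ~~ beval s b -> exec c2 s t1 s1 ->
    exec (If b c1 c2) s (btime b + t1).+1 s1
| EWhileTrue b c s s1 s2 t1 t2 :
    beval s b -> exec c s t1 s1 -> exec (While b c) s1 t2 s2 ->
    exec (While b c) s (btime b + t1 + t2).+1 s2
| EWhileFalse b c s :
    ~~ beval s b -> exec (While b c) s (btime b).+1 s.

End Semantics.

(* The current allotment is kept in nat array 0. *)
Definition holds R k n (s : state R) (A : allotment k n) : Prop :=
  forall d : 'I_n, nmem s 0 d = A d.

Definition initial_state R k n (A : allotment k n) : state R :=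
  State (fun a x => if a == 0%N then
                      if insub x is Some d then val (A d) else 0%N
                    else 0%N)
        (fun _ _ => 0).

(* The machine states that arise when [build] is run once, on some instance
   with an allotment inducing no negative cost loop, and [insert] is then run
   after each arrival of a new demand unit, on the memory left by the previous
   run.  The starting instance may have no demand unit at all. *)
Inductive maintained (build insert : cmd) (R : realDomainType) (k : nat)
    (sc : centers R k) : forall n, demand k n -> state R -> Prop :=
| MBuild n (D : demand k n) (A : allotment k n) t s :
    ~ has_negative_loop sc D A ->
    exec sc D build (initial_state R A) t s ->
    maintained build insert sc D s
| MInsert n (D : demand k n) (D' : demand k n.+1) s t s' :
    maintained build insert sc D s ->
    extends D' D ->
    exec sc D' insert s t s' ->
    maintained build insert sc D' s'.

(* Main.v *)
(* Node potentials certify the absence of negative loops.  Put a sink behind the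
   centers, with arcs b -> sink of cost q_b(o_b + 1) and sink -> a of cost
   - q_a(o_a) when o_a > 0; a loop of either kind is then a simple cycle of this
   residual graph.  Without negative cycles the distances ds from the new unit
   are potentials.  Augmenting along a tight simple path x -> ... -> y -> sink
   keeps them valid: a moved unit changes center along a tight arc, and only the
   load of y changes, where the penalty is nondecreasing.
     The distances are found by k+1 rounds of Bellman-Ford on k+1 nodes, and the
   tight path by breadth-first search, both in O(k^3).  The cheapest unit for
   each transfer i -> j is at the root of a segment tree over the units; the at
   most k moves refresh O(k) branches of length O(log n) each. *)

Require Import Defs.
From mathcomp Require Import all_boot all_order all_algebra.
From mathcomp Require Import zify lra.
Set Implicit Arguments.
Unset Strict Implicit.
Unset Printing Implicit Defensive.
Import Order.TTheory GRing.Theory Num.Theory.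

(** * Timed execution *)

(** The invariant behind the augmentation is complementary slackness: every unit d sits at a center
    j that maximizes its potential minus the cost of d there. Along a tight arc the unit that
    realizes the arc has equal value at both ends, so the potentials stay fixed during all the
    moves. They are not carried over to the next insertion: only the allotment, the loads and the
    tree index persist, and the residual graph is read anew off the tree roots. Tight arcs may close
    cycles of cost zero, so following them backwards blindly need not end. The search therefore
    supplies depth labels that strictly decrease towards the roots. They bound the walk, make the
    path simple, and ensure that a unit selected before the first move is still at its center when
    its turn comes. A move changes leaves only in the 2k trees of its two centers, whereas a new
    unit refreshes all k^2 trees once. *)

Definition nset R (s : state R) a x v := State (update (nmem s) a x v) (vmem s).
Definition vset R (s : state R) a x v := State (nmem s) (update (vmem s) a x v).

Notation var a := (NLoad a (NConst 0)).
Notation set_var a e := (NStore a (NConst 0) e).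

Definition for_loop a e c :=
  Seq (set_var a (NConst 0))
      (While (NLe (NOp Add (var a) (NConst 1)) e)
             (Seq c (set_var a (NOp Add (var a) (NConst 1))))).

(** Loop guards have two shapes here: a counter plus one against a limit, or the constant 1 against
    a cell. The array tested thus serves as a name for the loop, and one function can bound all
    iteration counts. *)
Definition guard_array b :=
  match b with
  | NLe (NOp _ (NLoad a _) _) _ => a
  | NLe _ (NLoad a _) => a
  | _ => 0
  end.

(* [B a] bounds the number of iterations of a loop whose guard tests array [a]. *)
Fixpoint max_time (B : nat -> nat) c :=
  match c with
  | Skip => 1
  | NStore _ e1 e2 => (ntime e1 + ntime e2).+1
  | VStore _ e1 e2 => (ntime e1 + vtime e2).+1
  | Seq c1 c2 => (max_time B c1 + max_time B c2).+1
  | If b c1 c2 => (btime b + maxn (max_time B c1) (max_time B c2)).+1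
  | While b c =>
      B (guard_array b) * (btime b + max_time B c).+1 + (btime b).+1
  end.

Section Run.
Variables (R : realDomainType) (k n : nat).
Variables (sc : centers R k) (D : demand k n) (B : nat -> nat).

(** [maintained] supplies arbitrary executions; determinism identifies their final states with those
    of the runs constructed below. *)
Lemma exec_det c s t1 s1 t2 s2 :
  exec sc D c s t1 s1 -> exec sc D c s t2 s2 -> s1 = s2.
Proof.
move=> ex1; elim: ex1 t2 s2 => {c s t1 s1}
  [s|s a e1 e2|s a e1 e2|c1 c2 s s1 s2 t1 t2 _ IH1 _ IH2|b c1 c2 s s1 t1 Hb _ IH
  |b c1 c2 s s1 t1 Hb _ IH|b c s s1 s2 t1 t2 Hb _ IH1 _ IH2|b c s Hb] t3 s3 ex;
  inversion ex as [ | | |? ? ? s4 ? ? ? ex1 ex2|? ? ? ? ? ? Hb' ex1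
    |? ? ? ? ? ? Hb' ex1|? ? ? s4 ? ? ? Hb' ex1 ex2|? ? ? Hb']; subst=> //;
  try by [rewrite Hb in Hb' | rewrite Hb' in Hb].
- by rewrite -(IH1 _ _ ex1) in ex2; exact: IH2 ex2.
- exact: IH ex1.
- exact: IH ex1.
- by rewrite -(IH1 _ _ ex1) in ex2; exact: IH2 ex2.
Qed.

(** Total correctness with a syntactic time bound: the rules below carry only postconditions, and
    time is settled by a separate computation of [max_time]. *)
Definition runs c s (Q : state R -> Prop) :=
  exists t s', [/\ exec sc D c s t s', t <= max_time B c & Q s'].

Lemma runs_weaken c s (Q Q' : state R -> Prop) :
  (forall s', Q s' -> Q' s') -> runs c s Q -> runs c s Q'.
Proof. by move=> QQ' [t [s' [ex le_t /QQ' Q's]]]; exists t, s'. Qed.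

Lemma runs_skip s (Q : state R -> Prop) : Q s -> runs Skip s Q.
Proof. by move=> Qs; exists 1, s; split=> //; constructor. Qed.

Lemma runs_nstore s a e1 e2 (Q : state R -> Prop) :
  Q (nset s a (neval n sc s e1) (neval n sc s e2)) -> runs (NStore a e1 e2) s Q.
Proof. by move=> Qs; do 2!eexists; split; [constructor | | exact: Qs]. Qed.

Lemma runs_vstore s a e1 e2 (Q : state R -> Prop) :
  Q (vset s a (neval n sc s e1) (veval sc D s e2)) -> runs (VStore a e1 e2) s Q.
Proof. by move=> Qs; do 2!eexists; split; [constructor | | exact: Qs]. Qed.

Lemma runs_seq s c1 c2 (Q : state R -> Prop) :
  runs c1 s (fun s1 => runs c2 s1 Q) -> runs (Seq c1 c2) s Q.
Proof.
case=> t1 [s1 [ex1 le1 [t2 [s2 [ex2 le2 Qs]]]]]; exists (t1 + t2).+1, s2.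
by split=> //=; [apply: ESeq ex1 ex2 | rewrite ltnS leq_add].
Qed.

Lemma runs_if s b c1 c2 (Q : state R -> Prop) :
  (beval sc D s b -> runs c1 s Q) -> (~~ beval sc D s b -> runs c2 s Q) ->
  runs (If b c1 c2) s Q.
Proof.
have [Hb /(_ isT) + _|Hb _ /(_ isT)] := boolP (beval sc D s b).
- case=> t [s' [ex le_t Qs]]; exists (btime b + t).+1, s'; split=> //=.
    exact: EIfTrue.
  by rewrite ltnS leq_add2l (leq_trans le_t) ?leq_maxl.
- case=> t [s' [ex le_t Qs]]; exists (btime b + t).+1, s'; split=> //=.
    exact: EIfFalse.
  by rewrite ltnS leq_add2l (leq_trans le_t) ?leq_maxr.
Qed.

(** The index of [I] is fuel, the number of iterations still allowed. A true guard must therefore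
    exhibit a successor. *)
Lemma runs_while (I : nat -> state R -> Prop) j s b c (Q : state R -> Prop) :
  j <= B (guard_array b) -> I j s ->
  (forall i s1, I i s1 -> beval sc D s1 b ->
     exists2 i', i = i'.+1 & runs c s1 (I i')) ->
  (forall i s1, I i s1 -> ~~ beval sc D s1 b -> Q s1) ->
  runs (While b c) s Q.
Proof.
move=> le_j Ij step stop.
suff [t [s' [ex le_t Qs]]] : exists t s', [/\ exec sc D (While b c) s t s',
    t <= j * (btime b + max_time B c).+1 + (btime b).+1 & Q s'].
  exists t, s'; split=> //=; apply: leq_trans le_t _.
  by rewrite leq_add2r leq_mul2r le_j orbT.
elim: j s {le_j} Ij => [|j IHj] s Ij; have [Hb|Hb] := boolP (beval sc D s b).
- by have [] := step _ _ Ij Hb.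
- by exists (btime b).+1, s; split; [apply: EWhileFalse | | apply: stop Ij Hb].
- have [_ [<-] [t [s1 [ex1 le1 /IHj[t2 [s2 [ex2 le2 Qs2]]]]]]] := step _ _ Ij Hb.
  exists (btime b + t + t2).+1, s2; split=> //; first exact: EWhileTrue ex1 ex2.
  by rewrite mulSn; lia.
- exists (btime b).+1, s; split; [exact: EWhileFalse | | exact: stop Ij Hb].
  by rewrite leq_addl.
Qed.

Lemma runs_for (I : nat -> state R -> Prop) N s a e c (Q : state R -> Prop) :
  N <= B a -> I 0 (nset s a 0 0) ->
  (forall i s1, I i s1 -> neval n sc s1 e = N) ->
  (forall i s1, i < N -> nmem s1 a 0 = i -> I i s1 ->
     runs c s1 (fun s2 => nmem s2 a 0 = i /\ I i.+1 (nset s2 a 0 i.+1))) ->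
  (forall s1, nmem s1 a 0 = N -> I N s1 -> Q s1) -> runs (for_loop a e c) s Q.
Proof.
move=> le_N I0 Ie step stop; apply/runs_seq/runs_nstore.
apply: (@runs_while (fun j s1 => [/\ j <= N, nmem s1 a 0 = N - j & I (N - j) s1]) N).
- exact: le_N.
- by rewrite subnn; split=> //=; rewrite /update !eqxx.
- move=> j s1 [le_j Ea Ij] /=; rewrite Ea (Ie _ _ Ij) addn1.
  case: j => [|j] in le_j Ij Ea *; first by rewrite subn0 ltnn.
  move=> lt_N; exists j => //; apply: runs_seq; have := step _ _ lt_N Ea Ij.
  apply: runs_weaken => s2 [Ea2 I2]; apply: runs_nstore; rewrite /= Ea2 addn1 subnSK //.
  split; [exact: ltnW | by rewrite /= /update !eqxx | by rewrite -(subnSK le_j)].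
- move=> j s1 [le_j Ea Ij] /=; rewrite Ea (Ie _ _ Ij) addn1 -leqNgt => le_N'.
  have E : N - j = N by apply/eqP; rewrite eqn_leq leq_subr.
  by apply: stop; rewrite -E.
Qed.

End Run.

(** * Shortest distances and residual cycles *)

Section TightLevels.
Variables (V : Type) (R : realDomainType) (E : rel V) (W : V -> V -> R).
Variables (f ds : V -> R).
Local Open Scope ring_scope.

(** These levels measure the progress of both program loops: after r rounds the relaxation is exact
    on level r, and the search has reached all of it. *)
Fixpoint tight_level r v : Prop :=
  if r is r'.+1 then
    tight_level r' v \/
    exists u, [/\ tight_level r' u, E u v & ds v = ds u + W u v]
  else ds v = f v.

Lemma tight_levelW r r' v : (r <= r')%N -> tight_level r v -> tight_level r' v.
Proof. by move/subnK <-; elim: (_ - _)%N => //= m IH /IH; left. Qed.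

End TightLevels.

Section ShortestPaths.
Variables (V : finType) (R : realDomainType) (E : rel V) (W : V -> V -> R).
Variables (f : V -> R).
Local Open Scope ring_scope.

Fixpoint path_cost x p := if p is y :: p' then W x y + path_cost y p' else 0.

Lemma path_cost_cat x p q :
  path_cost x (p ++ q) = path_cost x p + path_cost (last x p) q.
Proof. by elim: p x => [|y p IH] x /=; rewrite ?add0r // IH addrA. Qed.

Hypothesis cycle_ge0 : forall x p, uniq (x :: p) -> path E x p ->
  E (last x p) x -> 0 <= path_cost x p + W (last x p) x.

Let size_simple (x : V) p : uniq (x :: p) -> (size p <= #|V|)%N.
Proof.
by move=> Up; apply/ltnW; have := max_card (mem (x :: p)); rewrite (card_uniqP Up).
Qed.

(** Bounded sequences put all simple paths into a finite type, where a cheapest one exists. *)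
Let simple v (xp : V * {bseq #|V| of V}) :=
  [&& path E xp.1 xp.2, uniq (xp.1 :: xp.2) & last xp.1 xp.2 == v].
Let cost (xp : V * {bseq #|V| of V}) := f xp.1 + path_cost xp.1 xp.2.
Let dist v := cost [arg min_(xp < (v, [bseq]) | simple v xp) cost xp]%O.

Let dist_le x p : path E x p -> uniq (x :: p) ->
  dist (last x p) <= f x + path_cost x p.
Proof.
move=> Ep Up; have le_p := size_simple Up.
rewrite /dist; case: Order.TotalTheory.arg_minP => [|xp _ /(_ (x, Bseq le_p))].
  by rewrite /simple /= eqxx.
by apply; rewrite /simple Ep eqxx -andbA andbT.
Qed.

Let dist_ex v : exists x p, [/\ path E x p, uniq (x :: p), last x p = v &
  dist v = f x + path_cost x p].
Proof.
rewrite /dist; case: Order.TotalTheory.arg_minP => [|[x p] /and3P[Ep Up /eqP<-] _].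
  by rewrite /simple /= eqxx.
by exists x, p.
Qed.

(** [f] stands for the arcs out of a virtual source. The distance is a minimum over simple paths,
    and removing a cycle never raises the cost, which gives the triangle inequality. Prefixes of a
    shortest path are shortest, so its arcs are tight. *)
Lemma shortest_distances : exists ds : V -> R,
  [/\ forall v, ds v <= f v,
      forall u v, E u v -> ds v <= ds u + W u v &
      forall v, tight_level E W f ds #|V| v].
Proof.
have triangle u v : E u v -> dist v <= dist u + W u v.
  have [x [p [Ep Up <- ->]]] := dist_ex u => Euv.
  have [v_xp|v_xp] := boolP (v \in x :: p).
    (* The part of the path after [v], closed by the arc back to [v], is a cycle of nonnegative
       cost; the part before it is already a simple path to [v]. *)
    case/splitPl: v_xp Ep Up Euv => p1 p2 lastv.
    rewrite cat_path lastv -cat_cons cat_uniq last_cat lastv path_cost_cat lastv.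
    move=> /andP[Ep1 Ep2] /and3P[Up1 dis Up2] Euv.
    have Ucyc : uniq (v :: p2).
      rewrite /= Up2 andbT; apply: contra dis => v_p2; apply/hasP; exists v => //.
      by rewrite -lastv mem_last.
    have := dist_le Ep1 Up1; rewrite lastv.
    have := cycle_ge0 Ucyc Ep2 Euv; lra.
  have := @dist_le x (rcons p v); rewrite last_rcons rcons_path Ep Euv.
  rewrite -rcons_cons rcons_uniq v_xp Up => /(_ isT isT).
  by rewrite -cats1 path_cost_cat /= addr0 addrA.
exists dist; split=> // [v|v]; first by have := @dist_le v [::] isT isT; rewrite addr0.
have [x [p [Ep Up Lp Dp]]] := dist_ex v.
apply: (tight_levelW (size_simple Up)).
elim/last_ind: p v Ep Up Lp Dp => [|p y IH] v; first by rewrite /= addr0 => _ _ <- ->.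
rewrite rcons_path last_rcons -rcons_cons rcons_uniq size_rcons.
move=> /andP[Ep Ey] /andP[_ Up] <-.
rewrite -cats1 path_cost_cat /= addr0 => Dy.
(* Both inequalities must be equalities, since their sum is the cost of a shortest path. *)
have le1 := dist_le Ep Up; have le2 := triangle _ _ Ey.
have D' : dist (last x p) = f x + path_cost x p by lra.
right; exists (last x p); split=> //; last by lra.
exact: IH.
Qed.

End ShortestPaths.

Section Potentials.
Variables (R : realDomainType) (k n : nat).
Variables (sc : centers R k) (D : demand k n) (A : allotment k n).
Local Open Scope ring_scope.

Lemma penalty_le i m m' : (m <= m')%N -> penalty sc i m <= penalty sc i m'.
Proof.
move=> le_m; have [le_c|lt_c] := leqP m (capacity sc i); last exact: penalty_mono.
rewrite (penalty_eq0 le_c); have [le_c'|lt_c'] := leqP m' (capacity sc i).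
  by rewrite penalty_eq0.
exact/ltW/penalty_gt0.
Qed.

(* [dt] is the potential of the sink behind the centers. *)
Lemma potentials_no_negative_loop (ds : 'I_k -> R) dt :
  (forall u j, ds j - (D u j)%:R <= ds (A u) - (D u (A u))%:R) ->
  (forall i, dt <= ds i + penalty sc i (load A i).+1) ->
  (forall i, (0 < load A i)%N -> ds i + penalty sc i (load A i) <= dt) ->
  ~ has_negative_loop sc D A.
Proof.
move=> P1 P2 P3.
have edge_ge e : transfer_edge A e -> ds (dst e) - ds (src e) <= edge_cost R D e.
  by case/andP=> /eqP Ae _; have := P1 (unit_of e) (dst e); rewrite Ae /edge_cost; lra.
have walk_ge p a b : walk A a p b -> ds b - ds a <= \sum_(e <- p) edge_cost R D e.
  elim: p a => [|e p IH] a /=; first by move/eqP->; rewrite big_nil subrr.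
  by case/and3P=> /edge_ge le_e /eqP <- /IH; rewrite big_cons; lra.
case=> c [a b p e _ /andP[/walk_ge le_p _] /edge_ge le_e Es Ed|a b p].
  by move: le_e; rewrite Es Ed; lra.
move=> neq_ab /andP[W_p _]; have le_p := walk_ge _ _ _ W_p.
(* The arc from the sink to [a] requires a unit at [a]; the first edge of the path moves one out of
   there. *)
suff o_gt0 : (0 < load A a)%N.
  by have := P2 b; have := P3 a o_gt0; rewrite /penalty_edge_cost; lra.
case: p W_p {le_p} => [|e p] /=; first by rewrite (negPf neq_ab).
case/and3P=> /andP[/eqP Ae _] /eqP <- _.
by apply/card_gt0P; exists (unit_of e); rewrite inE Ae.
Qed.

End Potentials.

Section ResidualCycles.
Variables (R : realDomainType) (k n : nat).
Variables (sc : centers R k) (D : demand k n) (A : allotment k n).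
Local Open Scope ring_scope.

(* The node [None] is a sink behind the centers: the penalty transfer edge from
   [b] to [a] is the detour from [b] to [a] through it. *)
Variables (E : rel (option 'I_k)) (W : option 'I_k -> option 'I_k -> R).
Hypothesis transferE : forall i j, E (Some i) (Some j) ->
  exists2 b, A b = i & W (Some i) (Some j) = (D b j)%:R - (D b i)%:R.
Hypothesis to_sinkE :
  forall i, W (Some i) None = penalty sc i (load A i).+1.
Hypothesis from_sinkE :
  forall i, W None (Some i) = - penalty sc i (load A i).
Hypothesis sinkE : ~~ E None None.

Lemma path_walk i q : uniq (i :: q) -> path E (Some i) (map Some q) ->
  exists es, [/\ walk A i es (last i q), map (@dst k n) es = q &
    \sum_(e <- es) edge_cost R D e = path_cost W (Some i) (map Some q)].
Proof.
elim: q i => [|j q IH] i; first by exists [::]; rewrite big_nil /= eqxx.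
rewrite cons_uniq inE negb_or -andbA => /and3P[neq_ij _ Uq] /= /andP[Eij Eq].
have [es [Wes Des Ces]] := IH j Uq Eq; have [b Ab Wij] := transferE Eij.
exists (Edge i j b :: es); split; rewrite /= ?Des // ?big_cons ?Ces ?Wij //.
by rewrite /transfer_edge /= Ab !eqxx eq_sym neq_ij Wes.
Qed.

Lemma some_seq (T : eqType) (p : seq (option T)) : None \notin p ->
  exists q, p = map Some q.
Proof.
elim: p => [|[x|] p IH] //; first by exists [::].
by rewrite inE => /IH[q ->]; exists (x :: q).
Qed.

(** A cycle through the sink is rotated to begin there and becomes a penalty loop; any other is a
    transfer loop. Cycles with a single center are no loops and are treated apart: through the sink
    they cost q(o + 1) - q(o), and a transfer from a center to itself costs 0. *)
Lemma residual_cycle_ge0 : ~ has_negative_loop sc D A ->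
  forall x p, uniq (x :: p) -> path E x p -> E (last x p) x ->
    0 <= path_cost W x p + W (last x p) x.
Proof.
move=> noneg; have loop_ge0 c : induced_loop sc D A c -> 0 <= c.
  by move=> lc; rewrite leNgt; apply/negP => lt_c; apply: noneg; exists c.
have sink_ge0 p : uniq (None :: p) -> path E None p -> E (last None p) None ->
    0 <= path_cost W None p + W (last None p) None.
  rewrite cons_uniq => /andP[/some_seq[[|i q] ->]]; first by rewrite /= (negPf sinkE).
  rewrite map_inj_uniq => [Uq|? ? [] //].
  rewrite /= last_map to_sinkE from_sinkE => /andP[_ Eq] _.
  have [es [Wes Des <-]] := path_walk Uq Eq.
  case: q => [|j q] in Uq Eq Wes Des *.
    have := penalty_le sc i (leqnSn (load A i)).
    by case: es Des {Wes} => // _; rewrite big_nil /=; lra.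
  have : induced_loop sc D A (\sum_(e <- es) edge_cost R D e +
      penalty_edge_cost sc A (last j q) i).
    apply: PenaltyLoop; last by rewrite /simple_path Wes Des.
    by apply: contraTneq Uq => -> /=; rewrite mem_last.
  by move/loop_ge0; rewrite /penalty_edge_cost /=; lra.
move=> x p Up Ep Ex; have [|] := boolP (None \in x :: p); last first.
  case/some_seq=> [[//|i q]] [? ?]; subst x p; move: Up Ep Ex.
  rewrite -map_cons map_inj_uniq => [Uq Eq|? ? [] //].
  rewrite last_map => Ei; have [b Ab ->] := transferE Ei.
  have [es [Wes Des <-]] := path_walk Uq Eq.
  case: q => [|j q] in Uq Eq Ei Wes Des Ab *.
    by case: es Des {Wes} => // _; rewrite big_nil /=; lra.
  have neq_ij : i != last j q by apply: contraTneq Uq => -> /=; rewrite mem_last.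
  apply: loop_ge0; apply: (@TransferLoop _ _ _ _ _ _ i (last j q) es
    (Edge (last j q) i b)) => //; first by rewrite /simple_path Wes Des.
  by rewrite /transfer_edge /= Ab eqxx neq_ij.
rewrite inE => /orP[/eqP xN|]; first by subst x; exact: sink_ge0.
move=> Np; case/splitPr: Np Up Ep Ex => p1 p2.
rewrite -cat_cons uniq_catC cat_path last_cat path_cost_cat /=.
move=> Up /and3P[Ep1 E1 Ep2] Ex.
have := @sink_ge0 (p2 ++ x :: p1) Up.
rewrite cat_path last_cat path_cost_cat /= Ep2 Ex Ep1 => /(_ isT E1); lra.
Qed.

End ResidualCycles.

(** * Segment trees over the units *)

Notation alloc := 0 (only parsing).
Notation tree := 1 (only parsing).
Notation half := 2 (only parsing).
Notation loads := 3 (only parsing).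
Notation edges := 4 (only parsing).
Notation reach := 5 (only parsing).
Notation pred_of := 6 (only parsing).
Notation height := 10 (only parsing).
Notation width := 11 (only parsing).
Notation unit_ := 12 (only parsing).
Notation center := 13 (only parsing).
Notation target := 14 (only parsing).
Notation level := 15 (only parsing).
Notation node := 16 (only parsing).
Notation left := 17 (only parsing).
Notation right := 18 (only parsing).
Notation round := 19 (only parsing).
Notation current := 22 (only parsing).
Notation previous := 23 (only parsing).
Notation scan := 24 (only parsing).
(* These two name arrays of values, which have their own numbering. *)
Notation weight := 0 (only parsing).
Notation dist := 1 (only parsing).

(* Unlike a row-major index, this code is injective on all of nat * nat. *)
Definition pair_code a b := (a + b) * (a + b) + b.

Lemma pair_code_inj a b c d :
  pair_code a b = pair_code c d -> a = c /\ b = d.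
Proof.
rewrite /pair_code => eq_ab; suff E : a + b = c + d by rewrite E in eq_ab; lia.
(* The code lies between the consecutive squares of a + b and a + b + 1, the latter excluded, so it
   determines a + b. *)
by case: (ltngtP (a + b) (c + d)) => //; nia.
Qed.

Definition epair e1 e2 := NOp Add (NOp Mul (NOp Add e1 e2) (NOp Add e1 e2)) e2.
Definition tree_addr h x :=
  epair (epair h x) (epair (var center) (var target)).
Definition ekey d :=
  VOp Defs.Sub (VCost d (var target)) (VCost d (var center)).
Definition epred e := NOp Defs.Sub e (NConst 1).
Definition esucc e := NOp Add e (NConst 1).
Definition edouble e := NOp Add e e.
Definition eeq e1 e2 := BAnd (NLe e1 e2) (NLe e2 e1).

Definition merge_children :=
  Seq (set_var node (NLoad half (var node)))
  (Seq (set_var left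
         (NLoad tree (tree_addr (var level) (edouble (var node)))))
  (Seq (set_var right
         (NLoad tree (tree_addr (var level) (esucc (edouble (var node))))))
  (If (BAnd (NLe (NConst 1) (var left))
        (BNot (BAnd (NLe (NConst 1) (var right))
          (BNot (VLe (ekey (epred (var left))) (ekey (epred (var right))))))))
     (NStore tree (tree_addr (esucc (var level)) (var node)) (var left))
     (NStore tree (tree_addr (esucc (var level)) (var node)) (var right))))).

Definition refresh_branch :=
  Seq (set_var node (var unit_))
  (Seq (If (eeq (NLoad alloc (var unit_)) (var center))
          (NStore tree (tree_addr (NConst 0) (var node)) (esucc (var unit_)))
          (NStore tree (tree_addr (NConst 0) (var node)) (NConst 0)))
       (for_loop level (var height) merge_children)).

Definition refresh_unit := for_loop target NCenters refresh_branch.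

(* The machine cannot divide: cells 2d and 2d+1 of [half] are filled when unit d arrives. *)
Definition add_unit :=
  Seq (NStore half (edouble (var unit_)) (var unit_))
  (Seq (NStore half (esucc (edouble (var unit_))) (var unit_))
  (Seq (If (NLe (var width) (var unit_))
          (Seq (set_var height (esucc (var height)))
               (set_var width (edouble (var width))))
          Skip)
       (for_loop center NCenters refresh_unit))).

(* Node [x] of level [h] covers the units d with d %/ 2 ^ h = x; the tree of the
   pair (i, j) ranks the units at center i by the cost of a transfer to j. *)
Definition tree_cell R (s : state R) i j h x :=
  nmem s tree (pair_code (pair_code h x) (pair_code i j)).

Section Frames.
Variable R : realDomainType.
Implicit Types s : state R.

Definition agree (L : seq nat) s s' :=
  forall a, a \notin L -> nmem s' a = nmem s a.

Lemma agree_trans L s1 s2 s3 : agree L s1 s2 -> agree L s2 s3 -> agree L s1 s3.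
Proof. by move=> n12 n23 a aL; rewrite n23 // n12. Qed.

Lemma agree_sub (L L' : seq nat) s s' :
  subseq L L' -> agree L s s' -> agree L' s s'.
Proof.
by move=> /mem_subseq sLL' n12 a aL'; apply: n12; exact: contra (sLL' a) aL'.
Qed.

Lemma agree_nset L s s' a x v : a \in L -> agree L s s' -> agree L s (nset s' a x v).
Proof.
move=> aL nE b bL; rewrite -nE //= /update.
by rewrite (negPf (_ : b != a)) //; apply: contraNneq bL => ->.
Qed.

Lemma tree_cell_set s i j h x v i' j' h' x' :
  tree_cell (nset s tree (pair_code (pair_code h x) (pair_code i j)) v) i' j' h' x' =
  if [&& i' == i, j' == j, h' == h & x' == x] then v else tree_cell s i' j' h' x'.
Proof.
rewrite /tree_cell /= /update /=; case: ifP => [/eqP|]; last first.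
  by case: and4P => // -[/eqP-> /eqP-> /eqP-> /eqP->]; rewrite eqxx.
by case/pair_code_inj=> /pair_code_inj[-> ->] /pair_code_inj[-> ->]; rewrite !eqxx.
Qed.

End Frames.

Section BestUnit.
Variables (R : realDomainType) (key : nat -> R).

(* [c] is 0 when no unit satisfies [P], and otherwise 1 plus a cheapest one. *)
Definition best_unit (P : pred nat) c :=
  if c is d.+1 then P d /\ forall d', P d' -> (key d <= key d')%R
  else forall d, ~~ P d.

Lemma eq_best_unit P P' c : P =1 P' -> best_unit P c -> best_unit P' c.
Proof.
move=> eqP; case: c => [|d] /=; first by move=> nP d; rewrite -eqP.
by case=> Pd min; rewrite -eqP; split=> // d'; rewrite -eqP; exact: min.
Qed.

(** The condition is the guard of [merge_children] as evaluated: [l] is nonempty, and [r] is empty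
    or no cheaper. The disjunction is expressed by negation and conjunction. *)
Lemma best_unitU P P' l r : best_unit P l -> best_unit P' r ->
  best_unit (predU P P')
    (if (0 < l) && ~~ ((0 < r) && ~~ (key (l - 1) <= key (r - 1))%R) then l else r).
Proof.
case: l r => [|l] [|r] /=; rewrite ?subn1 //=.
- by move=> nP nP' d; rewrite negb_or nP nP'.
- move=> nP [Pr minr]; rewrite Pr orbT; split=> // d' /orP[|/minr//].
  by rewrite (negPf (nP _)).
- move=> [Pl minl] nP; rewrite Pl; split=> // d' /orP[/minl//|].
  by rewrite (negPf (nP _)).
- move=> [Pl minl] [Pr minr]; rewrite negbK.
  case: (leP (key l) (key r)) => [le_lr|/ltW le_rl] /=.
    rewrite Pl; split=> // d' /orP[/minl//|/minr]; exact: le_trans.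
  by rewrite Pr orbT; split=> // d' /orP[/minl|/minr//]; exact: le_trans.
Qed.

End BestUnit.

Definition in_node (al : nat -> nat) m i h x : pred nat :=
  fun d => [&& d < m, al d == i & d %/ 2 ^ h == x].

Lemma in_node_children al m i h x :
  predU (in_node al m i h (x + x)) (in_node al m i h (x + x + 1)) =1
  in_node al m i h.+1 x.
Proof.
move=> d; rewrite /in_node /= expnSr divnMA -!andb_orr.
by congr [&& _, _ & _]; move: (d %/ _) => y; lia.
Qed.

Section Refresh.
Variables (R : realDomainType) (k n : nat).
Variables (sc : centers R k) (D : demand k n) (B : nat -> nat).

Definition key i j d : R := (read_cost R D d j - read_cost R D d i)%R.

Definition branch_arrays := [:: tree; level; node; left; right].

(** Only the ancestors of leaf [d] may be wrong, one on each level. Going up, each is merged from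
    two children that are already right. *)
Lemma refresh_branchP m d i j s (al := nmem s alloc) (H := nmem s height 0)
    (ok := fun s' h x => best_unit (key i j) (in_node al m i h x) (tree_cell s' i j h
      x)) :
  nmem s unit_ 0 = d -> nmem s center 0 = i -> nmem s target 0 = j ->
  d < m -> H <= B level ->
  (forall x, x <= d -> nmem s half x = x %/ 2) ->
  (forall h x, h <= H -> x != d %/ 2 ^ h -> ok s h x) ->
  runs sc D B refresh_branch s (fun s' =>
    [/\ agree branch_arrays s s',
        forall i' j' h x, [|| i' != i, j' != j | H < h] ->
          tree_cell s' i' j' h x = tree_cell s i' j' h x &
        forall h x, h <= H -> ok s' h x]).
Proof.
move=> Ed Ei Ej lt_dm le_H halfE okd.
pose I h s1 := [/\ agree branch_arrays s s1, nmem s1 node 0 = d %/ 2 ^ h,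
  forall i' j' h' x, [|| i' != i, j' != j | H < h'] ->
    tree_cell s1 i' j' h' x = tree_cell s i' j' h' x &
  forall h' x, h' <= H -> (h' <= h) || (x != d %/ 2 ^ h') -> ok s1 h' x].
apply/runs_seq/runs_nstore/runs_seq; rewrite /= Ed.
set s0 := nset s node 0 d.
suff start c : ok (nset s0 tree (pair_code (pair_code 0 d) (pair_code i j)) c) 0 d ->
    runs sc D B (for_loop level (var height) merge_children)
      (nset s0 tree (pair_code (pair_code 0 d) (pair_code i j)) c)
      (fun s' => [/\ agree branch_arrays s s',
        forall i' j' h x, [|| i' != i, j' != j | H < h] ->
          tree_cell s' i' j' h x = tree_cell s i' j' h x &
        forall h x, h <= H -> ok s' h x]).
  apply: runs_if => /=; rewrite /update /= -eqn_leq Ed Ei => Eal;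
    apply: runs_nstore; rewrite /= /update /= ?Ed Ei Ej; apply: start.
  - rewrite /ok tree_cell_set !eqxx /= addn1 /= /in_node lt_dm Eal expn0 divn1 eqxx.
    by split=> // d' /and3P[_ _]; rewrite divn1 => /eqP->.
  - rewrite /ok tree_cell_set !eqxx /= /in_node => d'; rewrite expn0 divn1.
    by have [->|_] := eqVneq d' d; rewrite ?(negPf Eal) ?andbF.
move=> okc; set s1 := nset s0 _ _ _.
apply: (@runs_for _ _ _ _ _ _ I H) => //.
- split=> [||i' j' h' x ne|h' x le_h' ne].
  + by do !apply: agree_nset.
  + by rewrite expn0 divn1.
  + have -> : tree_cell (nset s1 level 0 0) i' j' h' x = tree_cell s1 i' j' h' x by [].
    rewrite /s1 tree_cell_set; case: and4P => // -[/eqP ? /eqP ? /eqP ? _]; subst.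
    by rewrite !eqxx ltn0 in ne.
  + have : ok s1 h' x; last by [].
    have [/andP[/eqP-> /eqP->]|ne'] := boolP ((h' == 0) && (x == d)); first exact: okc.
    rewrite /ok tree_cell_set !eqxx /= (negPf ne'); apply: okd => //.
    case: h' ne ne' le_h' => [|h'] //=; by rewrite expn0 divn1.
- by move=> h s2 [ag _ _ _] /=; rewrite ag.
- move=> h s2 lt_h Eh [ag Enode fr oks]; have ag' := ag.
  have Ei2 : nmem s2 center 0 = i by rewrite ag'.
  have Ej2 : nmem s2 target 0 = j by rewrite ag'.
  set y := d %/ 2 ^ h.+1.
  have Ey : nmem s2 half (nmem s2 node 0) = y.
    by rewrite ag' // Enode halfE ?leq_div // /y expnSr divnMA.
  apply/runs_seq/runs_nstore/runs_seq/runs_nstore/runs_seq/runs_nstore.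
  rewrite /= Ey /update /= Ei2 Ej2 Eh.
  rewrite -/(tree_cell s2 i j h (y + y)) -/(tree_cell s2 i j h (y + y + 1)).
  set l := tree_cell _ _ _ _ _; set r := tree_cell _ _ _ _ _.
  set s3 := nset _ right 0 r.
  have okm : best_unit (key i j) (in_node al m i h.+1 y)
     (if (0 < l) && ~~ ((0 < r) && ~~ (key i j (l - 1) <= key i j (r - 1))%R) then l
       else r).
    apply: eq_best_unit (in_node_children al m i h y) _.
    by apply: best_unitU; apply: oks; rewrite ?leqnn // ltnW.
  suff finish c' : best_unit (key i j) (in_node al m i h.+1 y) c' ->
      I h.+1 (nset (nset s3 tree (pair_code (pair_code h.+1 y) (pair_code i j)) c')
        level 0 h.+1).
    apply: runs_if => /= Hb; apply: runs_nstore;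
      rewrite /= /update /= Ei2 Ej2 Eh addn1 -/s3; split=> //; apply: finish; move: okm;
      move: Hb; rewrite /= /update /= Ei2 Ej2; by [move=> -> | move/negPf->].
  move=> okc'; split=> [||i' j' h' x ne|h' x le_h' ne].
  + by do !apply: agree_nset.
  + by [].
  + rewrite -(fr _ _ _ _ ne) [LHS]tree_cell_set;
    case: and4P => // -[/eqP ? /eqP ? /eqP ? _]; subst.
    by rewrite !eqxx ltnNge lt_h in ne.
  + rewrite /ok [tree_cell _ _ _ _ _]tree_cell_set !eqxx /=.
    case: ifP => [/andP[/eqP-> /eqP->]|ne'] //; apply: oks => //.
    case/orP: ne => [|->]; last by rewrite orbT.
    rewrite leq_eqVlt ltnS => /orP[/eqP Eh'|->] //.
    by rewrite Eh' eqxx /= in ne' *; rewrite ne' orbT.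
- move=> s2 _ [ag _ fr oks]; split=> // h x le_h; apply: oks => //; by rewrite le_h.
Qed.

Definition unit_arrays := target :: branch_arrays.

Lemma refresh_unitP m d i s (al := nmem s alloc) (H := nmem s height 0)
    (ok := fun s' j h x => best_unit (key i j) (in_node al m i h x) (tree_cell s' i j h
      x)) :
  nmem s unit_ 0 = d -> nmem s center 0 = i ->
  d < m -> H <= B level -> k <= B target ->
  (forall x, x <= d -> nmem s half x = x %/ 2) ->
  (forall j h x, j < k -> h <= H -> x != d %/ 2 ^ h -> ok s j h x) ->
  runs sc D B refresh_unit s (fun s' =>
    [/\ agree unit_arrays s s',
        forall i' j h x, (i' != i) || (H < h) ->
          tree_cell s' i' j h x = tree_cell s i' j h x &
        forall j h x, j < k -> h <= H -> ok s' j h x]).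
Proof.
move=> Ed Ei lt_dm le_H le_k halfE okd.
apply: (@runs_for _ _ _ _ _ _ (fun j s1 => [/\ agree unit_arrays s s1,
  forall i' j' h x, (i' != i) || (H < h) ->
    tree_cell s1 i' j' h x = tree_cell s i' j' h x &
  forall j' h x, j' < k -> h <= H -> (j' < j) || (x != d %/ 2 ^ h) ->
    ok s1 j' h x]) k) => //.
- by split=> //; apply: agree_nset.
- move=> j s1 lt_j Ej [ag fr oks]; have ag' := ag.
  have al1 : nmem s1 alloc = al by rewrite ag'.
  have H1 : nmem s1 height 0 = H by rewrite ag'.
  have Ed1 : nmem s1 unit_ 0 = d by rewrite ag'.
  have Ei1 : nmem s1 center 0 = i by rewrite ag'.
  have := @refresh_branchP m d i j s1; rewrite al1 H1 [nmem s1 half]ag' //.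
  move=> /(_ Ed1 Ei1 Ej lt_dm le_H halfE) []; first by move=> h x le_h ne; apply: oks;
    rewrite ?ne ?orbT.
  move=> t [s2 [ex le_t [ag2 fr2 oks2]]]; exists t, s2; split=> //.
  have ag3 : agree unit_arrays s s2 by apply: agree_trans ag _; exact: agree_sub ag2.
  split; first by rewrite ag2.
  split=> [|i' j' h x ne|j' h x lt_j' le_h ne]; first exact: agree_nset.
    by rewrite -(fr _ j' _ x ne); apply: fr2; case/orP: ne => ->; rewrite ?orbT.
  have [->|ne_j] := eqVneq j' j; first exact: oks2.
  rewrite /ok [tree_cell _ _ _ _ _]fr2 ?ne_j ?orbT //; apply: oks => //.
  by case/orP: ne => [|->]; rewrite ?orbT // ltnS leq_eqVlt (negPf ne_j) /= => ->.
- by move=> s1 _ [ag fr oks]; split=> // j h x lt_j le_h; apply: oks => //; rewrite lt_j.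
Qed.

(** [height_small] keeps the tree no taller than the units require, whence the logarithm in the time
    bound. [tree_zero] makes a level opened later read as empty. The node [x] ranges over all of
    nat, so the unoccupied part of a level is described too. *)
Record indexed m (s : state R) (H := nmem s height 0) : Prop := Indexed {
  half_ok : forall x, x < m + m -> nmem s half x = x %/ 2;
  width_ok : nmem s width 0 = 2 ^ H;
  width_ge : m <= 2 ^ H;
  height_small : 0 < H -> 2 ^ H.-1 < m;
  tree_ok : forall i j h x, i < k -> j < k -> h <= H ->
    best_unit (key i j) (in_node (nmem s alloc) m i h x) (tree_cell s i j h x);
  tree_zero : forall i j h x, H < h -> tree_cell s i j h x = 0 }.

Lemma height_le m H : (0 < H -> 2 ^ H.-1 < m.+1) -> H <= (trunc_log 2 m).+1.
Proof.
case: H => //= H /(_ isT); case: m => [|m] le_m.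
  by have := expn_gt0 2 H; move: le_m; case: (2 ^ H).
by rewrite ltnS trunc_log_max.
Qed.

Lemma eq_in_node (al al' : nat -> nat) m i h x :
  (forall d, d < m -> al d = al' d) -> in_node al m i h x =1 in_node al' m i h x.
Proof. by move=> E d; rewrite /in_node; case lt_d: (d < m) => //=; rewrite E. Qed.

Definition index_arrays := [:: half, height, width, center & unit_arrays].

(** All trees are refreshed, not only those of the center that receives the unit: when the height
    grows, each needs the value of its new root, which lies on the branch of unit [m]. *)
Lemma add_unitP m s : indexed m s -> nmem s unit_ 0 = m ->
  (trunc_log 2 m).+1 <= B level -> k <= B center -> k <= B target ->
  runs sc D B add_unit s (fun s' => agree index_arrays s s' /\ indexed m.+1 s').
Proof.
move=> [hf wd le_w sm tr zr] Em le_B le_kc le_kt.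
apply/runs_seq/runs_nstore/runs_seq/runs_nstore/runs_seq; rewrite /= /update /= !Em.
set s1 := nset _ _ _ m.
have half1 x : x < m.+1 + m.+1 -> nmem s1 half x = x %/ 2.
  rewrite /s1 /= /update /=; have [->|ne1] := eqVneq x; first by lia.
  have [->|ne2] := eqVneq x; first by lia.
  by move=> lt_x; apply: hf; lia.
set H := nmem s height 0 in wd le_w sm tr zr.
pose al := nmem s alloc.
pose ready H2 s2 :=
 [/\ agree index_arrays s s2 /\ nmem s2 half = nmem s1 half, 
   [/\ nmem s2 height 0 = H2, nmem s2 width 0 = 2 ^ H2, m < 2 ^ H2 & (0 < H2 ->
     2 ^ H2.-1 < m.+1)],
   forall i j h x, i < k -> j < k -> h <= H2 -> x != m %/ 2 ^ h ->
    best_unit (key i j) (in_node al m.+1 i h x) (tree_cell s2 i j h x) &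
   forall i j h x, H2 < h -> tree_cell s2 i j h x = 0].
have nodeS i h x : x != m %/ 2 ^ h -> in_node al m i h x =1 in_node al m.+1 i h x.
  move=> ne d; rewrite /in_node ltnS [d <= m]leq_eqVlt.
  by have [->|] := eqVneq d m; rewrite /= ?ltnn ?[_ == x]eq_sym ?(negPf ne) ?andbF.
suff go H2 s2 : ready H2 s2 -> runs sc D B (for_loop center NCenters refresh_unit) s2
    (fun s' => agree index_arrays s s' /\ indexed m.+1 s').
  apply: runs_if; rewrite /= /update /= Em wd => lew.
    apply/runs_seq/runs_nstore/runs_nstore;
      rewrite /= /update /= wd addn1 addnn -mul2n -expnS.
    rewrite -/H; set s2 := nset _ _ _ _; apply: (go H.+1).
    have eq_w : m = 2 ^ H by apply/eqP; rewrite eqn_leq le_w.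
    split.
    - by split=> //; do !apply: agree_nset.
    - by split=> //; rewrite ?eq_w ?ltnS // ltn_exp2l.
    - move=> i j h x lt_i lt_j; rewrite leq_eqVlt => /orP[/eqP->|lt_h] ne; last first.
        by apply: eq_best_unit (nodeS i h x ne) _; exact: tr.
      (* Growth happens exactly when m = 2 ^ H. All units, the new one included, then lie below node
         0 of the new level, so its other nodes rightly hold 0. *)
      rewrite [tree_cell _ _ _ _ _]zr //= => d; rewrite /in_node.
      have lt_m : m < 2 ^ H.+1 by rewrite eq_w ltn_exp2l.
      apply/and3P=> -[lt_d _ /eqP Ex]; rewrite -Ex !divn_small ?eqxx // in ne.
      by apply: leq_trans lt_d _.
    - by move=> i j h x lt_h; apply: zr; apply: ltn_trans lt_h.
  apply: runs_skip; apply: (go H); rewrite -ltnNge in lew.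
  split=> //; last 1 first.
  - move=> i j h x lt_i lt_j le_h ne; apply: eq_best_unit (nodeS i h x ne) _; exact: tr.
  - by split=> //; do !apply: agree_nset.
  - by split=> // /sm; exact: leq_trans.
case=> -[ag half2] [EH2 wd2 lt_w sm2] tr2 zr2.
have ag' := ag; have al2 : nmem s2 alloc = al by rewrite ag'.
have um : nmem s2 unit_ 0 = m by rewrite ag'.
pose L := center :: unit_arrays.
apply: (@runs_for _ _ _ _ _ _ (fun i s3 => [/\ agree L s2 s3,
  forall i' j h x, i' < k -> j < k -> h <= H2 -> (i' < i) || (x != m %/ 2 ^ h) ->
    best_unit (key i' j) (in_node al m.+1 i' h x) (tree_cell s3 i' j h x) &
  forall i' j h x, H2 < h -> tree_cell s3 i' j h x = 0]) k) => //.
- by split=> //; apply: agree_nset.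
- move=> i s3 lt_i Ei [ag3 tr3 zr3]; have ag3' := ag3.
  have al3 : nmem s3 alloc = al by rewrite ag3'.
  have H3 : nmem s3 height 0 = H2 by rewrite ag3'.
  have um3 : nmem s3 unit_ 0 = m by rewrite ag3'.
  have := @refresh_unitP m.+1 m i s3; rewrite al3 H3 [nmem s3 half]ag3' // half2.
  move=> /(_ um3 Ei (leqnn _) (leq_trans (height_le sm2) le_B) le_kt) [].
  + by move=> x le_x; apply: half1;
    rewrite addSn addnS ltnS (leq_trans le_x) // ltnW // ltnS leq_addr.
  + by move=> j h x lt_j le_h ne; apply: tr3; rewrite ?ne ?orbT.
  move=> t [s4 [ex le_t [ag4 fr4 oks4]]]; exists t, s4; split=> //.
  have ag5 : agree L s2 s4 by apply: agree_trans ag3 _; exact: agree_sub ag4.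
  split; first by rewrite ag4.
  split=> [|i' j h x lt_i' lt_j le_h ne|i' j h x lt_h]; first exact: agree_nset.
    have [->|ne_i] := eqVneq i' i; first exact: oks4.
    rewrite [tree_cell _ _ _ _ _]fr4 ?ne_i //; apply: tr3 => //.
    by case/orP: ne => [|->]; rewrite ?orbT // ltnS leq_eqVlt (negPf ne_i) /= => ->.
  by rewrite [LHS]fr4 ?lt_h ?orbT //; exact: zr3.
- move=> s3 _ [ag3 tr3 zr3]; have ag3' := ag3.
  have ag4 : agree index_arrays s s3 by apply: agree_trans ag _; exact: agree_sub ag3.
  split=> //; split; rewrite !ag3' ?EH2 ?half2 ?al2 //.
  by move=> i j h x lt_i lt_j le_h; apply: tr3; rewrite ?lt_i.
Qed.

End Refresh.

(** * Shortest tight paths *)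

Notation ctr := (var center).
Notation tgt := (var target).
Notation sink := NCenters.
Notation new_unit := (NOp Defs.Sub NUnits (NConst 1)).
Notation edge_exp := (NLoad edges (epair ctr tgt)).
Notation weight_exp := (VLoad weight (epair ctr tgt)).

Definition for_pairs c :=
  for_loop center (esucc NCenters) (for_loop target (esucc NCenters) c).

Definition put_edge e w :=
  Seq (NStore edges (epair ctr tgt) e) (VStore weight (epair ctr tgt) w).

(** The flag in [edges] is stored first, because the weight of a transfer arc reads it. For an empty
    tree the truncated predecessor makes that weight refer to unit 0; the flag 0 masks it. *)
Definition fill_graph :=
  for_pairs
    (If (NLe (esucc ctr) NCenters)
      (If (NLe (esucc tgt) NCenters)
        (put_edge (NLoad tree (tree_addr (var height) (NConst 0))) (ekey (epred
          edge_exp)))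
        (put_edge (NConst 1) (VPenalty ctr (esucc (NLoad loads ctr)))))
      (If (NLe (esucc tgt) NCenters)
        (put_edge (NLoad loads tgt)
          (VOp Defs.Sub (VConst 0) (VPenalty tgt (NLoad loads tgt))))
        (put_edge (NConst 0) (VConst 0)))).

(* The sink starts 1 above the cost of a walk through center 0, so that it is
   never mistaken for a root of the tight forest. *)
Definition init_distances :=
  Seq (for_loop target NCenters
        (Seq (VStore dist tgt (VCost new_unit tgt)) (NStore reach tgt (NConst 0))))
  (Seq (VStore dist sink (VOp Add (VConst 1)
         (VOp Add (VLoad dist (NConst 0)) (VLoad weight (epair (NConst 0) sink)))))
       (NStore reach sink (NConst 0))).

Definition relaxed := VOp Add (VLoad dist ctr) weight_exp.

Definition bellman_ford :=
  for_loop round (esucc NCenters) (for_pairs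
    (If (BAnd (NLe (NConst 1) edge_exp) (BNot (VLe (VLoad dist tgt) relaxed)))
      (VStore dist tgt relaxed) Skip)).

Definition mark_sources :=
  for_loop target NCenters
    (If (VLe (VCost new_unit tgt) (VLoad dist tgt))
      (Seq (NStore reach tgt (NConst 1)) (NStore pred_of tgt (NConst 0))) Skip).

(** At exact distances the inequality test selects the tight arcs. A round expands only nodes marked
    in earlier rounds, so depth strictly increases from parent to child. *)
Definition search :=
  for_loop round (esucc NCenters) (for_pairs
    (If (BAnd (NLe (NConst 1) edge_exp)
        (BAnd (BAnd (NLe (NConst 1) (NLoad reach ctr))
                    (NLe (NLoad reach ctr) (esucc (var round))))
        (BAnd (NLe (NLoad reach tgt) (NConst 0)) (VLe relaxed (VLoad dist tgt)))))
      (Seq (NStore reach tgt (esucc (esucc (var round)))) (NStore pred_of tgt (esucc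
        ctr)))
      Skip)).

Definition before (i j u v : nat) := (u < i) || ((u == i) && (v < j)).

Lemma before_next i j u v :
  before i j.+1 u v -> (u = i /\ v = j) \/ before i j u v.
Proof. by rewrite /before ltnS; lia. Qed.

Section Graph.
Variables (R : realDomainType) (k n : nat).
Variables (sc : centers R k) (D : demand k n) (B : nat -> nat).
Hypotheses (B_center : k < B center) (B_target : k < B target) (B_round : k < B round).
Implicit Types s : state R.
Local Notation runs := (runs sc D B).
Local Notation K := k.+1.

Definition edge_at s u v := nmem s edges (pair_code u v).
Definition weight_at s u v := vmem s weight (pair_code u v).
Definition pair_arrays := [:: center; target].

Lemma runs_pairs (I : nat -> nat -> state R -> Prop) s c (Q : state R -> Prop) :
  (forall i j a x v s1, a \in pair_arrays -> I i j s1 -> I i j (nset s1 a x v)) ->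
  I 0 0 s -> (forall i s1, I i K s1 -> I i.+1 0 s1) ->
  (forall i j s1, i < K -> j < K -> nmem s1 center 0 = i -> nmem s1 target 0 = j ->
     I i j s1 -> runs c s1 (fun s2 =>
       [/\ nmem s2 center 0 = i, nmem s2 target 0 = j & I i j.+1 s2])) ->
  (forall s1, I K 0 s1 -> Q s1) -> runs (for_pairs c) s Q.
Proof.
move=> Iset I0 IK step stop.
apply: (@runs_for _ _ _ _ _ _ (fun i s1 => I i 0 s1) K) => //.
- exact: Iset.
- by move=> i s1 _; rewrite /= addn1.
- move=> i s1 lt_i Ei I1.
  apply: (@runs_for _ _ _ _ _ _ (fun j s2 => nmem s2 center 0 = i /\ I i j s2) K) => //.
  + by split=> //; exact: Iset.
  + by move=> j s2 _; rewrite /= addn1.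
  + move=> j s2 lt_j Ej [Ei2 I2]; apply: runs_weaken (step _ _ _ lt_i lt_j Ei2 Ej I2).
    by move=> s3 [Ei3 Ej3 I3]; do !split=> //; exact: Iset.
  + by move=> s2 _ [Ei2 I2]; split=> //; apply: Iset => //; exact: IK.
- by move=> s1 _; exact: stop.
Qed.

Section Fill.
Variable s : state R.
Let H := nmem s height 0.
Let L i := nmem s loads i.

(* Positive when there is an arc; for a transfer arc, 1 plus the unit that realizes its cost. *)
Definition graph_edge u v :=
  if u < k then if v < k then tree_cell s u v H 0 else 1
  else if v < k then L v else 0.

Definition graph_weight u v : R :=
  if u < k then
    if v < k then key R D u v (graph_edge u v - 1)
    else read_penalty sc u (L u).+1
  else if v < k then (0 - read_penalty sc v (L v))%R else 0%R.

Definition fill_arrays := edges :: pair_arrays.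

Lemma fill_graphP : runs fill_graph s (fun s' => agree fill_arrays s s' /\
  forall u v, u <= k -> v <= k ->
    edge_at s' u v = graph_edge u v /\ weight_at s' u v = graph_weight u v).
Proof.
apply: (@runs_pairs (fun i j s1 => agree fill_arrays s s1 /\
  forall u v, u <= k -> v <= k -> before i j u v ->
    edge_at s1 u v = graph_edge u v /\ weight_at s1 u v = graph_weight u v)).
- move=> i j a x v s1 a_in [ag fill].
  have a_in' : a \in fill_arrays by rewrite inE a_in orbT.
  split; first exact: agree_nset.
  by move=> u v' le_u le_v bef; rewrite /edge_at /= /update;
    move: a_in (fill u v' le_u le_v bef);
     rewrite !inE => /orP[]/eqP->.
- by split=> // u v _ _; rewrite /before ltn0 andbF.
- move=> i s1 [ag fill]; split=> // u v le_u le_v;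
  rewrite /before ltn0 andbF orbF ltnS => le_ui.
  apply: fill => //; rewrite /before ltnS le_v andbT.
  by move: le_ui; rewrite leq_eqVlt orbC.
- move=> i j s1 lt_i lt_j Ei Ej [ag fill].
  suff store e w : neval n sc s1 e = graph_edge i j ->
      veval sc D (nset s1 edges (pair_code i j) (graph_edge i j)) w = graph_weight i j ->
      runs (put_edge e w) s1 (fun s2 => [/\ nmem s2 center 0 = i, nmem s2 target 0 = j &
        agree fill_arrays s s2 /\ forall u v, u <= k -> v <= k -> before i j.+1 u v ->
        edge_at s2 u v = graph_edge u v /\ weight_at s2 u v = graph_weight u v]).
    have H1 : nmem s1 height 0 = H by rewrite ag.
    have L1 : nmem s1 loads = L by rewrite ag.
    have T1 : nmem s1 tree = nmem s tree by rewrite ag.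
    apply: runs_if => /= Hi; apply: runs_if => /= Hj; rewrite Ei Ej !addn1 in Hi Hj;
      apply: store; rewrite /= /graph_edge /graph_weight /= /update /= ?Ei ?Ej
        ?(negPf Hi) ?(negPf Hj) ?Hi ?Hj ?L1 ?addn1 //.
    + by rewrite T1 H1.
    + rewrite !eqxx /key /graph_edge Hi Hj; congr (_ - _)%R.
  move=> Ee Ew; apply/runs_seq/runs_nstore/runs_vstore; rewrite /= Ei Ej Ee Ew.
  split=> //; split=> [|u v le_u le_v]; first exact/agree_nset.
  rewrite /edge_at /weight_at /= /update /= Ei Ej -/(pair_code i j).
  case: (eqVneq (pair_code u v) (pair_code i j)) => [/pair_code_inj[-> ->] //|ne].
  case/before_next=> [[? ?]|]; last exact: fill.
  by subst; rewrite eqxx in ne.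
- move=> s1 [ag fill]; split=> // u v le_u le_v; apply: fill => //.
  by rewrite /before ltnS le_u.
Qed.

End Fill.
Section Distances.
Variables (E : rel nat) (W : nat -> nat -> R) (f ds : nat -> R).
Hypothesis E_bound : forall u v, E u v -> u < K /\ v < K.
Hypothesis ds_le : forall v, v < K -> (ds v <= f v)%R.
Hypothesis ds_triangle : forall u v, E u v -> (ds v <= ds u + W u v)%R.
Hypothesis ds_tight : forall v, v < K -> tight_level E W f ds K v.

Definition stores_graph s := forall u v, u < K -> v < K ->
  (0 < edge_at s u v) = E u v /\ weight_at s u v = W u v.

Definition round_arrays := round :: pair_arrays.

Lemma stores_graph_agree s s' : agree round_arrays s s' ->
  vmem s' weight = vmem s weight -> stores_graph s -> stores_graph s'.
Proof.
by move=> ag Ew gr u v; rewrite /edge_at /weight_at ag // Ew; exact: gr.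
Qed.

(** By the triangle inequality no relaxation drops below [ds], and in round r each tight arc out of
    level r brings its head down to [ds]. Updating in place only lowers values earlier, which is why
    [I] uses inequalities. *)
Lemma bellman_fordP s : stores_graph s -> (forall v, v < K -> vmem s dist v = f v) ->
  runs bellman_ford s (fun s' => [/\ agree round_arrays s s',
    vmem s' weight = vmem s weight & forall v, v < K -> vmem s' dist v = ds v]).
Proof.
move=> gr init.
pose I r s1 := [/\ agree round_arrays s s1, vmem s1 weight = vmem s weight,
  forall v, v < K -> (ds v <= vmem s1 dist v)%R &
  forall v, v < K -> tight_level E W f ds r v -> (vmem s1 dist v <= ds v)%R].
have Iset r a x v s1 : a \in round_arrays -> I r s1 -> I r (nset s1 a x v).
  by move=> a_in [ag Ew ge le]; split=> //; exact: agree_nset.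
apply: (@runs_for _ _ _ _ _ _ I K) => //.
- apply: Iset => //; split=> // v lt_v; rewrite init //; first exact: ds_le.
  by rewrite /tight_level => ->.
- by move=> r s1 _; rewrite /= addn1.
- move=> r s1 lt_r Er I1.
  pose J i j s2 := [/\ nmem s2 round 0 = r, I r s2 &
    forall u v, before i j u v -> tight_level E W f ds r u -> E u v ->
      ds v = (ds u + W u v)%R -> (vmem s2 dist v <= ds v)%R].
  apply: (@runs_pairs J) => //.
  + move=> i j a x v s2 a_in [Er2 I2 J2]; split=> //; last first.
      by apply: Iset => //; rewrite inE a_in orbT.
    by rewrite /= /update; move: a_in; rewrite !inE => /orP[]/eqP->.
  + by split=> // u v; rewrite /before ltn0 andbF.
  + move=> i s2 [Er2 I2 J2]; split=> // u v bef tu Euv; apply: J2 => //.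
    by move: bef (E_bound Euv).2; rewrite /before; lia.
  + move=> i j s2 lt_i lt_j Ei Ej [Er2 [ag Ew ge le] J2].
    have [Eij Wij] := stores_graph_agree ag Ew gr lt_i lt_j.
    apply: runs_if; rewrite /= Ei Ej -/(pair_code i j) -/(edge_at s2 i j)
      -/(weight_at s2 i j) Eij Wij => Hb; last first.
      apply: runs_skip; split=> //; split=> // u v /before_next[[-> ->]|]; last exact: J2.
      move=> ti Ht Et; move: Hb; rewrite Ht /= negbK => /le_trans; apply.
      by rewrite Et lerD2r le.
    case/andP: Hb => Ht; rewrite -ltNge => lt_d.
    apply: runs_vstore; rewrite /= Ei Ej -/(pair_code i j) -/(weight_at s2 i j) Wij.
    have ge_d : (ds j <= vmem s2 dist i + W i j)%R.
      by apply: le_trans (ds_triangle Ht) _; rewrite lerD2r ge.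
    split=> //; split=> //; first split=> //= v lt_v; rewrite /= /update /=.
    * by case: eqVneq => [->|_] //; exact: ge.
    * by case: eqVneq => [->|_] tv; [apply: le_trans (ltW lt_d) _ | ]; exact: le.
    * move=> u v bef tu Euv Et; case: eqVneq => [Ev|ne_v]; last first.
        by case/before_next: bef => [[_ Ev]|/J2]; [rewrite Ev eqxx in ne_v | exact].
      case/before_next: bef => [[Eu _]|/J2 J3].
        by subst u v; rewrite Et lerD2r le.
      by rewrite Ev in J3 Euv Et *; apply: le_trans (ltW lt_d) (J3 tu Euv Et).
  + move=> s2 [Er2 [ag Ew ge le] J2]; split=> //; apply: Iset => //; split=> // v lt_v.
    case=> [|[u [tu Euv Et]]]; first exact: le.
    by apply: (J2 u) => //; rewrite /before (E_bound Euv).1.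
- move=> s1 _ [ag Ew ge le]; split=> // v lt_v; apply/eqP.
  by rewrite eq_le ge // le //; exact: ds_tight.
Qed.

Definition search_arrays := [:: reach, pred_of & round_arrays].

(* The breadth-first forest of tight edges: [pred_of] is 0 at a root and 1 plus
   the parent elsewhere, [reach] is 1 plus the depth. *)
Definition forest b s := forall v, v < K -> 0 < nmem s reach v ->
  nmem s reach v <= b /\
  ((nmem s pred_of v = 0 /\ ds v = f v) \/
   exists u, [/\ nmem s pred_of v = u.+1, E u v, ds v = (ds u + W u v)%R &
     0 < nmem s reach u < nmem s reach v]).

Lemma searchP s : stores_graph s -> (forall v, v < K -> vmem s dist v = ds v) ->
  (forall v, v < K -> (0 < nmem s reach v) <-> ds v = f v) -> forest 1 s ->
  runs search s (fun s' => [/\ agree search_arrays s s', forest K.+1 s' &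
    forall v, v < K -> 0 < nmem s' reach v]).
Proof.
move=> gr dsE init_reach init_forest.
pose I r b s1 := [/\ agree search_arrays s s1, vmem s1 = vmem s, forest b s1 &
  forall v, v < K -> tight_level E W f ds r v -> 0 < nmem s1 reach v <= r.+1].
have Iset r b a x v s1 : a \in round_arrays -> I r b s1 -> I r b (nset s1 a x v).
  move=> a_in [ag Ev fo co]; split=> //; first by apply: agree_nset;
    rewrite // !inE in a_in *; rewrite a_in !orbT.
    by move=> w lt_w; move: a_in (fo w lt_w); rewrite /= /update !inE => /or3P[]/eqP->.
  by move=> w lt_w /(co w lt_w); move: a_in; rewrite /= /update !inE => /or3P[]/eqP->.
apply: (@runs_for _ _ _ _ _ _ (fun r => I r r.+1) K) => //.
- apply: Iset => //; split=> // v lt_v /(init_reach v lt_v) gt0.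
  by rewrite gt0; case: (init_forest v lt_v gt0).
- by move=> r s1 _; rewrite /= addn1.
- move=> r s1 lt_r Er I1.
  pose J i j s2 := [/\ nmem s2 round 0 = r, I r r.+2 s2 &
    forall u v, before i j u v -> 0 < nmem s2 reach u <= r.+1 -> E u v ->
      ds v = (ds u + W u v)%R -> 0 < nmem s2 reach v].
  apply: (@runs_pairs J) => //.
  + move=> i j a x v s2 a_in [Er2 I2 J2]; split=> //; last first.
    * by move=> u w; move: a_in (J2 u w); rewrite /= /update !inE => /orP[]/eqP->.
    * by apply: Iset => //; rewrite inE a_in orbT.
    by rewrite /= /update; move: a_in; rewrite !inE => /orP[]/eqP->.
  + split=> // [|u v]; last by rewrite /before ltn0 andbF.
    case: I1 => ag Ev fo co; split=> // v lt_v /(fo v lt_v)[le_r fov]; split=> //.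
    exact: leqW.
  + move=> i s2 [Er2 I2 J2]; split=> // u v bef tu Euv; apply: (J2 u) => //.
    by move: bef (E_bound Euv).2; rewrite /before; lia.
  + move=> i j s2 lt_i lt_j Ei Ej [Er2 I2 J2]; have [ag Ev fo co] := I2.
    have [Eij Wij] : (0 < edge_at s2 i j) = E i j /\ weight_at s2 i j = W i j.
      by rewrite /edge_at /weight_at ag // Ev; exact: gr.
    apply: runs_if; rewrite /= Ei Ej -/(pair_code i j) -/(edge_at s2 i j)
      -/(weight_at s2 i j) Eij Wij Ev !dsE // Er2 addn1 leqn0 => Hb; last first.
      apply: runs_skip; split=> //; split=> // u v /before_next[[-> ->]|]; last exact: J2.
      move=> rui Ht Et; move: Hb; rewrite Ht rui -Et lexx andbT /=.
      by rewrite lt0n.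
    case/and4P: Hb => Ht rui /eqP rj tight.
    have Et : ds j = (ds i + W i j)%R by apply/eqP; rewrite eq_le tight ds_triangle.
    apply/runs_seq/runs_nstore/runs_nstore; rewrite /= /update /= Ei Ej Er2 !addn1.
    set s3 := nset _ _ _ _.
    have reach3 w : nmem s3 reach w = if w == j then r.+2 else nmem s2 reach w by [].
    have pred3 w : nmem s3 pred_of w = if w == j then i.+1 else nmem s2 pred_of w by [].
    (* Only unmarked nodes are written, so earlier entries of the forest persist. *)
    have reach_keep w : 0 < nmem s2 reach w -> nmem s3 reach w = nmem s2 reach w.
      by rewrite reach3; case: eqVneq => // ->; rewrite rj.
    split=> //; split=> //; first split=> //.
    * by do !apply: agree_nset.
    * move=> w lt_w; rewrite reach3 pred3; case: eqVneq => [->|ne] rw.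
        split=> //; right; exists i; split=> //; rewrite reach_keep ?ltnS //.
        by case/andP: rui.
      have [le_w fow] := fo w lt_w rw; split=> //; case: fow => [|[u [Pu Eu Tu ru]]];
        first by left.
      by right; exists u; split=> //; rewrite reach_keep //; case/andP: ru.
    * by move=> w lt_w /(co w lt_w) rw; rewrite reach_keep //; case/andP: rw.
    * move=> u v bef; rewrite !reach3; case: (eqVneq v j) => // ne_v.
      case: eqVneq => [_|_]; first by rewrite ltnn.
      by case/before_next: bef => [[_ Ev']|]; [rewrite Ev' eqxx in ne_v | exact: J2].
  + move=> s2 [Er2 [ag Ev fo co] J2]; split=> //; apply: Iset => //; split=> // v lt_v tv.
    suff rv : 0 < nmem s2 reach v by rewrite rv; case: (fo v lt_v rv).
    case: tv => [|[u [tu Euv Et]]]; first by case/(co v lt_v)/andP.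
    apply: (J2 u) => //; first by rewrite /before (E_bound Euv).1.
    exact: co (E_bound Euv).1 tu.
- move=> s1 _ [ag Ew fo co]; split=> // v lt_v.
  by case/andP: (co v lt_v (ds_tight lt_v)).
Qed.

End Distances.

Lemma init_distancesP s (f := fun v : nat => if v < k then read_cost R D (n - 1) v
    else (1 + (read_cost R D (n - 1) 0 + weight_at s 0 k))%R) : 0 < k ->
  runs init_distances s (fun s' => [/\ agree [:: reach; target] s s',
    vmem s' weight = vmem s weight &
    forall v, v < K -> vmem s' dist v = f v /\ nmem s' reach v = 0]).
Proof.
move=> k_gt0; apply: runs_seq.
apply: (@runs_for _ _ _ _ _ _ (fun j s1 => [/\ agree [:: reach; target] s s1,
    vmem s1 weight = vmem s weight &
    forall v, v < j -> vmem s1 dist v = read_cost R D (n - 1) v /\ nmem s1 reach v =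
      0]) k).
- exact: ltnW.
- by split=> //; exact: agree_nset.
- by [].
- move=> j s1 lt_j Ej [ag Ew done]; apply/runs_seq/runs_vstore/runs_nstore; rewrite /= Ej.
  split=> //; split=> //; first by do !apply: agree_nset.
  move=> v; rewrite ltnS leq_eqVlt /= /update /= => /orP[/eqP->|lt_v];
    first by rewrite eqxx.
  by rewrite (ltn_eqF lt_v); exact: done.
move=> s1 _ [ag Ew done]; apply/runs_seq/runs_vstore/runs_nstore;
  rewrite /= (done 0 k_gt0).1.
split=> //; first exact: agree_nset.
move=> v; rewrite ltnS leq_eqVlt /f /= /update /= => /orP[/eqP->|lt_v].
  by rewrite eqxx ltnn Ew.
by rewrite (ltn_eqF lt_v) lt_v; exact: done.
Qed.

Lemma mark_sourcesP s (mark := fun v : nat =>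
    (v < k) && (read_cost R D (n - 1) v <= vmem s dist v)%R) :
  (forall v, v < K -> nmem s reach v = 0) ->
  runs mark_sources s (fun s' => [/\ agree [:: reach; pred_of; target] s s',
    vmem s' = vmem s & forall v, v < K ->
      nmem s' reach v = mark v /\ (mark v -> nmem s' pred_of v = 0)]).
Proof.
move=> reach0.
apply: (@runs_for _ _ _ _ _ _ (fun j s1 => [/\ agree [:: reach; pred_of; target] s s1,
    vmem s1 = vmem s & forall v, v < K ->
      nmem s1 reach v = (v < j) && mark v /\ ((v < j) && mark v ->
        nmem s1 pred_of v = 0)]) k).
- exact: ltnW.
- by split=> // [|v /reach0 rv]; [exact: agree_nset | split].
- by [].
- move=> j s1 lt_j Ej [ag Ev done].
  have done' v : v < K -> v != j -> nmem s1 reach v = (v < j.+1) && mark v /\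
      ((v < j.+1) && mark v -> nmem s1 pred_of v = 0).
    by move=> lt_v ne; have := done v lt_v; rewrite ltnS [v <= j]leq_eqVlt (negPf ne).
  apply: runs_if; rewrite /= Ej Ev => Hb.
    apply/runs_seq/runs_nstore/runs_nstore; rewrite /= /update /= Ej.
    split=> //; split=> //; first by do !apply: agree_nset.
    move=> v lt_v; rewrite /= /update /=; case: eqVneq => [->|]; last exact: done'.
    by rewrite /mark lt_j Hb ltnSn.
  apply: runs_skip; split=> //; split=> //; first exact: agree_nset.
  move=> v lt_v; rewrite /= /update /=; have [->|] := eqVneq v j; last exact: done'.
  have [-> _] := done j (ltnW lt_j : j < K).
  by rewrite ltnn /mark lt_j (negPf Hb) ltnSn.
- move=> s1 _ [ag Ev done]; split=> // v lt_v; have := done v lt_v.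
  by rewrite /mark; case: (v < k).
Qed.

End Graph.

(** * Augmentation *)

Notation cur := (var current).
Notation prev := (var previous).

(** The unit comes from [edges], filled before any move. Only the trees of its old and its new
    center have a changed leaf, so two refreshes suffice. *)
Definition move_unit :=
  Seq (set_var previous (epred (NLoad pred_of cur)))
  (Seq (set_var unit_ (epred (NLoad edges (epair prev cur))))
  (Seq (NStore alloc (var unit_) cur)
  (Seq (set_var center prev)
  (Seq refresh_unit
  (Seq (set_var center cur)
  (Seq refresh_unit (set_var current prev))))))).

(** The walk goes backwards from the sink along parent pointers. Each move fills the vacancy at the
    current center and opens one at its parent, and the new unit fills the last vacancy, at a root.
    Hence one update of [loads] is enough. *)
Definition augment :=
  Seq (set_var current (epred (NLoad pred_of sink)))
  (Seq (NStore loads cur (esucc (NLoad loads cur)))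
  (Seq (While (NLe (NConst 1) (NLoad pred_of cur)) move_unit)
  (Seq (NStore alloc new_unit cur)
  (Seq (set_var unit_ new_unit) add_unit)))).

Definition count_at (al : nat -> nat) m i := \sum_(d < m) (al d == i).

Lemma count_at_move al al' m d c i : d < m ->
  (forall e, al' e = if e == d then c else al e) ->
  count_at al' m i + (i == al d) = count_at al m i + (i == c).
Proof.
move=> lt_d alE; rewrite /count_at (bigD1 (Ordinal lt_d)) //= [in RHS](bigD1 (Ordinal
  lt_d)) //=.
rewrite alE eqxx (eq_sym i (al d)) (eq_sym i c).
have -> : \sum_(e < m | e != Ordinal lt_d) (al' e == i) = \sum_(e < m | e != Ordinal
  lt_d) (al e == i).
  by apply: eq_bigr => e; rewrite alE -val_eqE /= => /negPf->.
by rewrite addnC addnA addnAC.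
Qed.

Lemma in_node_move al al' m d c i h x :
  (forall e, al' e = if e == d then c else al e) ->
  (x != d %/ 2 ^ h) || ((i != al d) && (i != c)) ->
  in_node al' m i h x =1 in_node al m i h x.
Proof.
move=> alE ne e; rewrite /in_node alE; have [->|] := eqVneq e d => //.
case/orP: ne => [|/andP[]]; first by rewrite eq_sym => /negPf->; rewrite !andbF.
by rewrite ![i == _]eq_sym => /negPf-> /negPf->.
Qed.

Section Augment.
Variables (R : realDomainType) (k m : nat).
Variables (sc : centers R k) (D : demand k m.+1) (B : nat -> nat).
Hypotheses (B_center : k < B center) (B_target : k < B target).
Hypothesis B_level : (trunc_log 2 m).+1 <= B level.
Implicit Types s : state R.
Local Notation runs := (runs sc D B).
Local Notation K := k.+1.
Local Notation rc := (read_cost R D).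

Definition move_arrays := [:: alloc, current, previous, unit_, center & unit_arrays].

Lemma move_unitP s c u d (al := nmem s alloc) :
  indexed D m s -> nmem s current 0 = c -> nmem s pred_of c = u.+1 ->
  edge_at s u c = d.+1 -> d < m -> al d = u -> u < k -> c < k -> u != c ->
  runs move_unit s (fun s' => [/\ agree move_arrays s s', indexed D m s',
    nmem s' current 0 = u &
    forall e, nmem s' alloc e = if e == d then c else al e]).
Proof.
move=> [hf wd le_w sm tr zr] Ec Eu Ed lt_d ald lt_u lt_c neq_uc.
set H := nmem s height 0 in wd le_w sm tr zr.
apply/runs_seq/runs_nstore/runs_seq/runs_nstore/runs_seq/runs_nstore/runs_seq/runs_nstore.
rewrite /= /update /= Ec Eu /= subn1 /= -/(pair_code u c) -/(edge_at s u c) Ed subn1 /=.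
set s1 := nset _ center 0 u.
pose al1 := nmem s1 alloc.
have al1E e : al1 e = if e == d then c else al e by [].
have ag1 : agree move_arrays s s1 by do !apply: agree_nset.
have le_H : H <= B level.
  apply: leq_trans B_level; apply: height_le => /sm lt_m; exact: ltnW.
have half1 x : x <= d -> nmem s1 half x = x %/ 2.
  by move=> le_x; apply: hf; apply: leq_ltn_trans le_x _;
    apply: leq_trans lt_d (leq_addr _ _).
have tree1 i j h x : i < k -> j < k -> h <= H ->
    (x != d %/ 2 ^ h) || ((i != u) && (i != c)) ->
    best_unit (key R D i j) (in_node al1 m i h x) (tree_cell s1 i j h x).
  move=> lt_i lt_j le_h ne; apply: eq_best_unit (tr i j h x lt_i lt_j le_h).
  by apply: fsym; apply: in_node_move al1E _; rewrite ald.
apply: runs_seq.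
apply: runs_weaken (refresh_unitP (s :=
  s1) sc erefl erefl lt_d le_H (ltnW B_target) half1 _); last first.
  by move=> j h x lt_j le_h ne; apply: tree1; rewrite ?ne.
move=> s2 [ag2 fr2 tr2]; apply/runs_seq/runs_nstore.
have Ec2 : nmem s2 current 0 = c by rewrite ag2.
have Eu2 : nmem s2 previous 0 = u by rewrite ag2.
rewrite /= Ec2; set s3 := nset s2 center 0 c.
have ag3 : agree (center :: unit_arrays) s1 s3.
  by apply: agree_nset => //; apply: agree_sub ag2.
have al3 : nmem s3 alloc = al1 by rewrite ag3.
have H3 : nmem s3 height 0 = H by rewrite ag3.
have U3 : nmem s3 unit_ 0 = d by rewrite ag3.
have F3 : nmem s3 half = nmem s1 half by rewrite ag3.
apply: runs_seq.
have := @refresh_unitP _ _ _ sc D B m d c s3; rewrite al3 H3 F3.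
move=> /(_ U3 erefl lt_d le_H (ltnW B_target) half1) [].
  move=> j h x lt_j le_h ne; rewrite [tree_cell _ _ _ _ _]fr2 1?eq_sym ?neq_uc //.
  by apply: tree1; rewrite ?ne.
move=> t [s4 [ex le_t [ag4 fr4 tr4]]]; exists t, s4; split=> //; apply: runs_nstore.
have ag5 : agree (center :: unit_arrays) s1 s4.
  by apply: agree_trans ag3 _; apply: agree_sub ag4.
have ag6 : agree move_arrays s s4 by apply: agree_trans ag1 _; apply: agree_sub ag5.
have al4 : nmem s4 alloc = al1 by rewrite ag5.
have P4 : nmem s4 previous 0 = u by rewrite ag5.
rewrite /= P4; set s5 := nset s4 current 0 u.
have ag7 : agree move_arrays s s5 by apply: agree_nset.
have al5 : nmem s5 alloc = al1 by rewrite -al4.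
split=> //; last by move=> e; rewrite -[LHS]/(nmem s4 alloc e) al4.
split; rewrite ?(ag7 half) ?(ag7 width) ?(ag7 height) //.
- move=> i j h x lt_i lt_j le_h; rewrite al5.
  rewrite -[tree_cell _ _ _ _ _]/(tree_cell s4 i j h x).
  have [->|ne_c] := eqVneq i c; first exact: tr4.
  rewrite fr4 ?ne_c // -[tree_cell _ _ _ _ _]/(tree_cell s2 i j h x).
  have [->|ne_u] := eqVneq i u; first exact: tr2.
  by rewrite fr2 ?ne_u //; apply: tree1; rewrite // ne_u ne_c orbT.
- move=> i j h x lt_h; rewrite -[tree_cell _ _ _ _ _]/(tree_cell s4 i j h x).
  by rewrite fr4 ?lt_h ?orbT // [LHS]fr2 ?lt_h ?orbT //; exact: zr.
Qed.

Variables (E : rel nat) (W : nat -> nat -> R) (f ds : nat -> R).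
Hypothesis E_bound : forall u v, E u v -> u < K /\ v < K.
Hypothesis sinkE : ~~ E k k.
Hypothesis sink_root : ds k != f k.
Hypothesis source_cost : forall v, v < k -> f v = rc m v.
Hypothesis ds_le : forall v, v < K -> (ds v <= f v)%R.

(** Complementary slackness of unit [d]; over all units it becomes the first premise of
    [potentials_no_negative_loop]. *)
Definition fits al d := forall j, j < k -> (ds j - rc d j <= ds (al d) - rc d (al d))%R.

Lemma augmentP s (al0 := nmem s alloc) :
  indexed D m s -> (forall d, d < m -> al0 d < k /\ fits al0 d) ->
  (forall u v, u < k -> v < k -> E u v -> exists d,
     [/\ edge_at s u v = d.+1, d < m, al0 d = u & W u v = key R D u v d]) ->
  forest k E W f ds (B pred_of) s -> (forall v, v < K -> 0 < nmem s reach v) ->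
  runs augment s (fun s' => exists y, [/\ y < k, ds k = (ds y + W y k)%R,
    forall i, nmem s' loads i = nmem s loads i + (i == y),
    (indexed D m.+1 s' /\ forall d, d < m.+1 ->
      nmem s' alloc d < k /\ fits (nmem s' alloc) d) &
    forall i, count_at (nmem s' alloc) m.+1 i = count_at al0 m i + (i == y)]).
Proof.
move=> ix al_ok edgeE fo reached.
have [_ [[_ rk]|[y [Py Eyk Ty ry]]]] := fo k (ltnSn k) (reached _ (ltnSn k)).
  by have := sink_root; rewrite rk eqxx.
have lt_y : y < k.
  have [+ _] := E_bound Eyk; rewrite ltnS leq_eqVlt => /orP[/eqP Eyk'|//].
  by move: sinkE; rewrite -{1}Eyk' Eyk.
have below_sink v : v < K -> nmem s reach v < nmem s reach k -> v < k.
  by rewrite ltnS leq_eqVlt => /orP[/eqP->|//]; rewrite ltnn.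
apply/runs_seq/runs_nstore/runs_seq/runs_nstore; rewrite /= /update /= Py subn1 /= addn1.
set s1 := nset _ loads y _.
(* The fuel [r] bounds the depth label of the current center. Units that started at centers of
   smaller depth have not moved, and the unit of the next arc is among them. The last clause counts
   the vacancy at the current center. *)
pose J r s2 := [/\ agree move_arrays s1 s2, indexed D m s2,
  [/\ nmem s2 current 0 < k, nmem s reach (nmem s2 current 0) < nmem s reach k &
      nmem s reach (nmem s2 current 0) <= r],
  forall d, d < m -> [/\ nmem s2 alloc d < k, fits (nmem s2 alloc) d &
    nmem s reach (al0 d) < nmem s reach (nmem s2 current 0) -> nmem s2 alloc d = al0 d] &
  forall i, count_at (nmem s2 alloc) m i + (i == nmem s2 current 0) = count_at al0 m i
    + (i == y)].
apply: runs_seq; apply: (@runs_while _ _ _ _ _ _ J (B pred_of)) => //.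
- split=> //.
  + by case: ix => hf wd le_w sm tr zr; split.
  + by case/andP: ry => _ ry; split=> //=;
    case: (fo y (ltnW lt_y : y < K) (reached _ (ltnW lt_y))).
  + by move=> d /al_ok[].
- move=> r s2 [ag ix2 [lt_c rc_lt rc_le] al2 cnt2] /=.
  set c := nmem s2 current 0 in lt_c rc_lt rc_le al2 cnt2 *.
  have Pc : nmem s2 pred_of c = nmem s pred_of c by rewrite ag.
  rewrite Pc; have [_ [[-> _]|[u [Pu Euc Tu ru]]]] // :=
    fo c (ltnW lt_c : c < K) (reached _ (ltnW lt_c)).
  move=> _; have {}ru : nmem s reach u < nmem s reach c by case/andP: ru.
  have lt_u : u < k by apply: below_sink (E_bound Euc).1 _; apply: ltn_trans rc_lt.
  have [d [Ed lt_d ald Wd]] := edgeE u c lt_u lt_c Euc.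
  have [_ _ al2d] := al2 d lt_d.
  case: r => [|r] in rc_le *; first by move: (reached c (ltnW lt_c));
    rewrite lt0n -leqn0 rc_le.
  exists r => //.
  have Ed2 : edge_at s2 u c = d.+1 by rewrite /edge_at ag.
  have neq_uc : u != c by apply: contraTneq ru => ->; rewrite ltnn.
  have ald2 : nmem s2 alloc d = u by rewrite al2d // ald.
  apply: runs_weaken (move_unitP ix2 erefl (etrans Pc Pu) Ed2 lt_d ald2 lt_u lt_c neq_uc).
  move=> s3 [ag3 ix3 Ec3 al3]; split=> //; rewrite ?Ec3.
  + exact: agree_trans ag ag3.
  + split=> //; first exact: ltn_trans rc_lt.
    by rewrite -ltnS; apply: leq_trans rc_le.
  + move=> e lt_e; rewrite /fits al3; have [alek fe al2e] := al2 e lt_e.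
    case: eqVneq => [->|ne].
      split=> // [j lt_j|]; last by rewrite ald ltnn.
      (* The weight of the tight arc is the cost difference of [d] itself, so [d] has the same
         potential minus cost at [c] as at [u]. *)
      have [_ fd _] := al2 d lt_d; have := fd j lt_j; rewrite ald2 Tu Wd /key; lra.
    by split=> // lt_re; apply: al2e; apply: ltn_trans ru.
  + by move=> i; rewrite -cnt2 -(count_at_move i lt_d al3) ald2.
- move=> r s2 [ag ix2 [lt_c rc_lt rc_le] al2 cnt2] /=.
  set c := nmem s2 current 0 in lt_c rc_lt rc_le al2 cnt2 *.
  have Pc : nmem s2 pred_of c = nmem s pred_of c by rewrite ag.
  rewrite Pc; have [_ [[_ Rc]|[u [-> //]]]] :=
    fo c (ltnW lt_c : c < K) (reached _ (ltnW lt_c)).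
  move=> _; apply/runs_seq/runs_nstore/runs_seq/runs_nstore; rewrite /= subn1 /= -/c.
  set s3 := nset _ unit_ 0 m.
  have al3 d : nmem s3 alloc d = if d == m then c else nmem s2 alloc d by [].
  have al3' d : d < m -> nmem s3 alloc d = nmem s2 alloc d.
    by move=> lt_d; rewrite al3 (ltn_eqF lt_d).
  have ix3 : indexed D m s3.
    case: ix2 => hf wd le_w sm tr zr; split=> // i j h x lt_i lt_j le_h.
    apply: eq_best_unit (tr i j h x lt_i lt_j le_h).
    by apply: eq_in_node => d /al3'->.
  apply: runs_weaken (add_unitP sc ix3 erefl B_level (ltnW B_center) (ltnW B_target)).
  move=> s4 [ag4 ix4]; exists y.
  have -> : nmem s4 alloc = nmem s3 alloc by rewrite ag4.
  have -> : nmem s4 loads = nmem s1 loads by rewrite ag4 // -(ag loads).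
  split=> //.
  + by move=> i; rewrite /s1 /= /update /=; case: eqVneq => [->|]; rewrite ?addn1 ?addn0.
  + split=> // d; rewrite ltnS leq_eqVlt /fits al3.
    case: eqVneq => [-> _|ne /= lt_d]; last by case: (al2 d lt_d).
    (* The potential of a root equals the cost of the new unit there, and elsewhere it is at most
       that cost. *)
    split=> // j lt_j; have := ds_le (ltnW lt_j : j < K).
    by rewrite Rc !source_cost //; lra.
  + move=> i; rewrite -cnt2 /count_at big_ord_recr; congr (_ + _).
      by apply: eq_bigr => d _; rewrite -(al3' d (ltn_ord d)).
    by rewrite al3 eqxx eq_sym.
Qed.

End Augment.

(** * Complete insertion, construction of the index, and running time *)

Definition insert_unit :=
  Seq fill_graph (Seq init_distances (Seq bellman_ford
    (Seq mark_sources (Seq search augment)))).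

Definition build_index :=
  Seq (set_var width (NConst 1))
    (for_loop scan NUnits
      (Seq (set_var unit_ (var scan))
      (Seq (NStore loads (NLoad alloc (var unit_))
             (esucc (NLoad loads (NLoad alloc (var unit_)))))
           add_unit))).

Lemma read_costE (R : realDomainType) k n (D : demand k n) (d : 'I_n) (i : 'I_k) :
  read_cost R D d i = ((D d i)%:R)%R.
Proof. by rewrite /read_cost !valK. Qed.

Section Reads.
Variables (R : realDomainType) (k n : nat) (sc : centers R k).

Lemma read_penaltyE (i : 'I_k) p : read_penalty sc i p = penalty sc i p.
Proof. by rewrite /read_penalty valK. Qed.

Lemma read_cost_extends (D : demand k n) (D' : demand k n.+1) d i :
  extends D' D -> d < n -> i < k -> read_cost R D' d i = read_cost R D d i.
Proof.
move=> ext lt_d lt_i.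
rewrite (read_costE R D (Ordinal lt_d) (Ordinal lt_i)) -ext.
exact: (read_costE R D' (widen_ord (leqnSn n) (Ordinal lt_d)) (Ordinal lt_i)).
Qed.

Lemma load_count (A : allotment k n) (al : nat -> nat) (i : 'I_k) :
  (forall d : 'I_n, al d = A d) -> load A i = count_at al n i.
Proof.
move=> alE; rewrite /load -sum1dep_card big_mkcond /count_at.
by apply: eq_bigr => d _; rewrite alE val_eqE; case: eqP.
Qed.

Lemma eq_key_best_unit (key1 key2 : nat -> R) (P : pred nat) c :
  (forall d, P d -> key1 d = key2 d) -> best_unit key1 P c -> best_unit key2 P c.
Proof.
move=> E; case: c => [|d] //= [Pd min]; split=> // d' Pd'.
by rewrite -!E // min.
Qed.

Lemma indexed_extends (D : demand k n) (D' : demand k n.+1) (s : state R) :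
  extends D' D -> indexed D n s -> indexed D' n s.
Proof.
move=> ext [hf wd le_w sm tr zr]; split=> // i j h x lt_i lt_j le_h.
apply: eq_key_best_unit (tr i j h x lt_i lt_j le_h) => d /and3P[lt_d _ _].
by rewrite /key !(read_cost_extends ext).
Qed.

Definition consistent (D : demand k n) (s : state R) (A : allotment k n) :=
  [/\ holds s A, indexed D n s, forall i : 'I_k, nmem s loads i = load A i &
      ~ has_negative_loop sc D A].

End Reads.

Section Insert.
Variables (R : realDomainType) (k n : nat) (sc : centers R k).
Variables (D : demand k n) (D' : demand k n.+1) (A : allotment k n) (s : state R).
Hypotheses (k_gt0 : 0 < k) (ext : extends D' D) (ok : consistent sc D s A).
Local Notation K := k.+1.
Let E u v := [&& u < K, v < K & 0 < graph_edge k s u v].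
Let W := graph_weight sc D' s.
Let f v := if v < k then read_cost R D' n v
    else (1 + (read_cost R D' n 0 + W 0 k))%R.

(** The sink is node k in the arrays and [None] in the residual graph. *)
Let node_num (o : option 'I_k) : nat := if o is Some i then i else k.

Let node_num_insub v : v < K -> node_num (insub v) = v.
Proof.
by rewrite ltnS leq_eqVlt; case: insubP => [i _ <- //|/= /negPf->]; rewrite orbF => /eqP.
Qed.

Let edge_unit u v : u < k -> v < k -> E u v -> exists d : 'I_n,
  [/\ graph_edge k s u v = d.+1, A d = u :> nat & W u v = key R D' u v d].
Proof.
move=> lt_u lt_v /and3P[_ _]; rewrite /W /graph_weight /graph_edge lt_u lt_v.
have [Ah [_ _ _ _ tr _] _ _] := ok; have := tr u v _ 0 lt_u lt_v (leqnn _).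
case: (tree_cell _ _ _ _ _) => // d [/and3P[lt_d /eqP al_d _] _] _.
exists (Ordinal lt_d); rewrite subn1; split=> //.
by rewrite -al_d -(Ah (Ordinal lt_d)).
Qed.

(** The arcs involve old units only, whose costs agree in [D] and [D'], so the absence of negative
    loops before the insertion applies. The new unit enters through [f] alone. *)
Lemma insert_distances : exists ds : nat -> R,
  [/\ forall v, v < K -> (ds v <= f v)%R,
      forall u v, E u v -> (ds v <= ds u + W u v)%R &
      forall v, v < K -> tight_level E W f ds K v].
Proof.
have [Ah ix Ls noneg] := ok.
pose E' : rel (option 'I_k) := fun o o' => E (node_num o) (node_num o').
pose W' o o' := W (node_num o) (node_num o').
have cyc : forall x p, uniq (x :: p) -> path E' x p -> E' (last x p) x ->
    (0 <= path_cost W' x p + W' (last x p) x)%R.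
  apply: (residual_cycle_ge0 (sc := sc) (D := D) (A := A)) => //.
  - move=> i j /(edge_unit (ltn_ord i) (ltn_ord j))[d [_ Ad Wd]]; exists d;
    first exact: val_inj.
    rewrite /W' /= Wd /key !(read_cost_extends _ ext) //.
    by rewrite !read_costE.
  - by move=> i; rewrite /W' /= /W /graph_weight ltn_ord ltnn Ls read_penaltyE.
  - by move=> i; rewrite /W' /= /W /graph_weight ltn_ord ltnn Ls read_penaltyE sub0r.
  - by rewrite /E' /E /= /graph_edge !ltnn !andbF.
have [ds' [ds_le ds_tri ds_tight]] := shortest_distances (fun o => f (node_num o)) cyc.
pose ds v := ds' (insub v).
have dsE o : ds (node_num o) = ds' o.
  by case: o => [i|] /=; rewrite /ds ?valK ?insubN ?ltnn.
exists ds; split=> [v lt_v|u v Euv|v lt_v].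
- by rewrite -{2}(node_num_insub lt_v); exact: ds_le.
- have [lt_u lt_v _] := and3P Euv;
  rewrite -(node_num_insub lt_u) -(node_num_insub lt_v) !dsE.
  by apply: ds_tri; rewrite /E' !node_num_insub.
- have := ds_tight (insub v); rewrite card_option card_ord -{2}(node_num_insub lt_v).
  elim: K (insub v) => [|r IH] o /=; first by rewrite dsE.
  case=> [/IH|[u [/IH tu Euv Et]]]; first by left.
  by right; exists (node_num u); rewrite !dsE.
Qed.

Lemma insert_unitP B : k < B center -> k < B target -> k < B round ->
  k.+1 < B pred_of -> (trunc_log 2 n).+1 <= B level ->
  runs sc D' B insert_unit s (fun s' => exists A', consistent sc D' s' A').
Proof.
move=> Bc Bt Br Bp Bl; have [Ah ix Ls noneg] := ok.
have [ds [ds_le ds_tri ds_tight]] := insert_distances.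
have E_bound u v : E u v -> u < K /\ v < K by case/and3P.
have E0k : E 0 k by rewrite /E /graph_edge k_gt0 ltnn ltnSn.
have sink_lt : (ds k < f k)%R.
  apply: le_lt_trans (ds_tri _ _ E0k) _; rewrite /f ltnn.
  have := ds_le 0 (ltn0Sn k); rewrite /f k_gt0; lra.
apply: runs_seq; apply: runs_weaken (fill_graphP sc D' Bc Bt s) => s1 [ag1 gr1].
apply: runs_seq; apply: runs_weaken (init_distancesP sc D' Bt s1 k_gt0) =>
  s2 [ag2 Ew2 init2].
have gr2 : stores_graph k E W s2.
  move=> u v lt_u lt_v; have [Eu Ww] := gr1 u v lt_u lt_v.
  by rewrite /edge_at /weight_at ag2 // Ew2 -/(edge_at s1 u v) -/(weight_at s1 u v) Eu
    Ww /E lt_u lt_v.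
have init2' v : v < K -> vmem s2 dist v = f v.
  move=> lt_v; rewrite (init2 v lt_v).1 /f subn1 /=.
  by rewrite (gr1 0 k (leq0n _) (leqnn _)).2.
apply: runs_seq; apply: runs_weaken (bellman_fordP sc D' Bc Bt Br E_bound ds_le ds_tri
  ds_tight gr2 init2').
move=> s3 [ag3 Ew3 dist3].
have reach3 v : v < K -> nmem s3 reach v = 0 by move=> lt_v;
  rewrite ag3 // (init2 v lt_v).2.
apply: runs_seq; apply: runs_weaken (mark_sourcesP sc D' Bt reach3) => s4 [ag4 Ev4 mark4].
have source v : v < K ->
  (v < k) && (read_cost R D' (n.+1 - 1) v <= vmem s3 dist v)%R = (f v == ds v).
  move=> lt_v; rewrite dist3 // subn1 /f; case: ltnP => [lt_vk|le_v] /=.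
    by have := ds_le v lt_v; rewrite /f lt_vk eq_le => ->; rewrite andbT.
  have -> : v = k by apply/eqP; rewrite eqn_leq -ltnS lt_v.
  by have := sink_lt; rewrite /f ltnn => /gt_eqF->.
have gr4 : stores_graph k E W s4.
  move=> u v lt_u lt_v; rewrite /edge_at /weight_at ag4 // Ev4 ag3 // Ew3; exact: gr2.
have dist4 v : v < K -> vmem s4 dist v = ds v by move=> lt_v; rewrite Ev4 dist3.
have reach4 v : v < K -> (0 < nmem s4 reach v) <-> ds v = f v.
  move=> lt_v; rewrite (mark4 v lt_v).1 source // lt0b eq_sym; split; last by move=> ->.
  by move/eqP.
have forest4 : forest k E W f ds 1 s4.
  move=> v lt_v rv; have [-> P0] := mark4 v lt_v; split; first exact: leq_b1.
  move/(reach4 v lt_v): (rv) => dsv; left; split=> //; apply: P0.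
  by rewrite source // dsv.
apply: runs_seq; apply: runs_weaken (searchP sc D' Bc Bt Br E_bound ds_tri ds_tight gr4
  dist4 reach4 forest4).
move=> s5 [ag5 fo5 reach5].
have ag a : a \notin edges :: search_arrays -> nmem s5 a = nmem s a.
  rewrite !inE !negb_or => /and5P[a4 a5 a6 a19 /andP[a13 a14]].
  have ne l : {subset l <= [:: edges, reach, pred_of, round, center & [:: target]]} ->
    a \notin l.
    by move=> sub; apply: contra (sub a) _; rewrite !inE !negb_or a4 a5 a6 a19 a13 a14.
  rewrite ag5 ?ag4 ?ag3 ?ag2 ?ag1 //; apply: ne => b; rewrite !inE;
    by do ?[case/orP]; move=> /eqP->; rewrite eqxx ?orbT.
have cell5 i j h x : tree_cell s5 i j h x = tree_cell s i j h x by rewrite /tree_cell ag.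
have ix5 : indexed D' n s5.
  have [hf wd le_w sm tr zr] := indexed_extends ext ix.
  by split; rewrite ?(ag half) ?(ag width) ?(ag height) // => i j h x *;
    rewrite ?(ag alloc) // cell5; auto.
have al5 : nmem s5 alloc = nmem s alloc by rewrite ag.
have loads5 : nmem s5 loads = nmem s loads by rewrite ag.
(* The arc from i to j carries the cheapest transfer, so its triangle inequality implies the one for
   every unit at i. All units lie below node 0 at full height. *)
have fits5 d : d < n -> nmem s5 alloc d < k /\ fits D' ds (nmem s5 alloc) d.
  move=> lt_d; rewrite al5; have Ad := Ah (Ordinal lt_d); rewrite /= in Ad.
  rewrite /fits Ad; split=> // j lt_j; rewrite -Ad; set i := nmem s alloc d.
  have lt_i : i < k by rewrite /i Ad.
  have [_ _ _ _ tr _] := indexed_extends ext ix.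
  have := tr i j _ 0 lt_i lt_j (leqnn _).
  have in_d : in_node (nmem s alloc) n i (nmem s height 0) 0 d.
    by rewrite /in_node lt_d eqxx divn_small //; apply: leq_trans lt_d (width_ge ix).
  case Ec: (tree_cell _ _ _ _ _) => [|b] /=; first by move/(_ d); rewrite in_d.
  case=> _ /(_ d in_d); have Eij : E i j.
    by rewrite /E /graph_edge lt_i lt_j Ec !ltnS (ltnW lt_i) (ltnW lt_j).
  have := ds_tri i j Eij;
    rewrite /W /graph_weight /graph_edge lt_i lt_j Ec subn1 /= /key; lra.
have edges5 : forall u v, u < k -> v < k -> E u v -> exists d,
    [/\ edge_at s5 u v = d.+1, d < n, nmem s5 alloc d = u & W u v = key R D' u v d].
  move=> u v lt_u lt_v Euv; have [d [Ed Ad Wd]] := edge_unit lt_u lt_v Euv; exists d.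
  have [E1 _] := gr1 u v (ltnW lt_u) (ltnW lt_v).
  rewrite al5 (Ah d); split=> //; rewrite -Ed -E1 /edge_at.
  by rewrite ag5 // ag4 // ag3 // ag2.
have forest5 : forest k E W f ds (B pred_of) s5.
  move=> w lt_w rw; have [le_w tw] := fo5 w lt_w rw; split=> //.
  exact: leq_trans le_w Bp.
have noEkk : ~~ E k k by rewrite /E /graph_edge !ltnn !andbF.
have root_f : forall v, v < k -> f v = read_cost R D' n v by move=> w; rewrite /f => ->.
apply: runs_weaken (augmentP sc Bc Bt Bl E_bound noEkk _ root_f ds_le ix5 fits5 edges5
  forest5 reach5);
  last by rewrite lt_eqF.
move=> s6 [y [lt_y dsk loads6 [ix6 al6] cnt6]].
(* A mere default for [insubd]: every stored center is below k. *)
pose i0 := Ordinal k_gt0.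
pose A' : allotment k n.+1 := [ffun d : 'I_n.+1 => insubd i0 (nmem s6 alloc d)].
have A'E (d : 'I_n.+1) : nmem s6 alloc d = A' d.
  by rewrite ffunE val_insubd (al6 d (ltn_ord d)).1.
have load' i : load A' i = load A i + (i == y :> nat).
  rewrite (load_count i A'E) cnt6 al5 (load_count (al := nmem s alloc)) //.
have Wy : W y k = penalty sc (Ordinal lt_y) (load A (Ordinal lt_y)).+1.
  by rewrite /W /graph_weight lt_y ltnn (Ls (Ordinal lt_y)) (read_penaltyE sc (Ordinal
    lt_y)).
exists A'; split=> // [i|]; first by rewrite loads6 loads5 Ls load'.
apply: (@potentials_no_negative_loop _ _ _ _ _ _ (fun i => ds i) (ds k)) => [d j|i|i].
- have [_ /(_ j (ltn_ord j))] := al6 d (ltn_ord d).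
  by rewrite A'E !read_costE.
- rewrite load'; have [Ei|ne] := eqVneq (i : nat) y.
    have -> : i = Ordinal lt_y by exact: val_inj.
    (* The arc from [y] to the sink is tight at the old load plus one; the condition for the next
       unit is weaker by monotonicity. *)
    by rewrite dsk Wy lerD2l penalty_le // addn1.
  have Eik : E i k by rewrite /E /graph_edge ltn_ord ltnn !ltnSn ltnW // ltnS.
  by have := ds_tri i k Eik; rewrite /W /graph_weight ltn_ord ltnn Ls read_penaltyE addn0.
- rewrite load'; have [Ei|ne] := eqVneq (i : nat) y.
    have -> : i = Ordinal lt_y by exact: val_inj.
    by rewrite dsk Wy addn1.
  rewrite addn0 => load_gt0.
  have Eki : E k i by rewrite /E /graph_edge ltn_ord ltnn ltnSn Ls load_gt0 andbT ltnW
    // ltnS.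
  by have := ds_tri k i Eki; rewrite /W /graph_weight ltn_ord ltnn Ls read_penaltyE; lra.
Qed.

End Insert.

Lemma build_indexP (R : realDomainType) k n (sc : centers R k) (D : demand k n)
    (A : allotment k n) : ~ has_negative_loop sc D A ->
  exists t s, exec sc D build_index (initial_state R A) t s /\ consistent sc D s A.
Proof.
(* Only termination matters for the construction, so one crude bound serves all its loops. *)
move=> noneg; pose B (_ : nat) := (k + n).+1.
set s0 := initial_state R A; pose al := nmem s0 alloc.
have alE (d : 'I_n) : al d = A d by rewrite /al /= valK.
suff [t [s [ex _ ok]]] : runs sc D B build_index s0 (fun s => consistent sc D s A).
  by exists t, s.
apply/runs_seq/runs_nstore.
apply: (@runs_for _ _ _ _ _ _ (fun d s => [/\ nmem s alloc = al, indexed D d s &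
  forall i, nmem s loads i = count_at al d i]) n).
- by rewrite /B leqW // leq_addl.
- split; [by [] | | by move=> i; rewrite /count_at big_ord0].
  by split=> // i j h x lt_i lt_j le_h d; rewrite /in_node.
- by [].
- move=> d s lt_d Ed [al_s ix Ls]; apply/runs_seq/runs_nstore/runs_seq/runs_nstore.
  rewrite /= Ed /update /= al_s; set s1 := nset _ loads _ _.
  have ix1 : indexed D d s1 by case: ix => hf wd le_w sm tr zr; split.
  have le_B : (trunc_log 2 d).+1 <= B level.
    rewrite /B ltnS; apply: leq_trans (leq_trans (ltnW lt_d) (leq_addl k n)).
    by case: d {Ed ix Ls lt_d s1 ix1} => // d;
      apply: leq_trans (ltnW (ltn_expl _ _)) (trunc_logP _ _).
  have le_k : k <= (k + n).+1 by rewrite leqW // leq_addr.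
  apply: runs_weaken (add_unitP sc ix1 erefl le_B le_k le_k) => s2 [ag2 ix2].
  split; first by rewrite ag2.
  split.
  + by rewrite -al_s -[LHS]/(nmem s2 alloc) ag2.
  + by case: ix2 => hf wd le_w sm tr zr; split.
  + move=> i; rewrite -[LHS]/(nmem s2 loads i) ag2 // /s1 /= /update /=.
    rewrite /count_at big_ord_recr /= -/(count_at al d i) eq_sym.
    by case: eqVneq => [->|_]; rewrite ?addn0 Ls.
- move=> s _ [al_s ix Ls]; split=> // [d|i]; first by rewrite al_s.
  by rewrite Ls (load_count i alE).
Qed.

(** Loops over nodes run at most k + 1 times, and k + 2 is the largest depth label, hence the fuel
    of the walk back. The tree height after the insertion is at most one more than the logarithm of
    the old number of units. *)
Definition insert_bound k m (a : nat) : nat :=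
  if a == level then (trunc_log 2 m).+1 else k.+2.

(* 21 * 1000 exceeds the sum of the coefficients of the left-hand side. *)
Lemma insert_time k m : 0 < k ->
  max_time (insert_bound k m) insert_unit <= (21 * 1000) * (k ^ 3 + k ^ 2 * trunc_log 2
    m).
Proof.
move=> k_gt0; rewrite /insert_bound; set l := trunc_log 2 m.
cbn -[expn addn muln maxn leq].
have -> : k ^ 2 = k * k by rewrite expnS expn1.
have -> : k ^ 3 = k * k * k by rewrite !expnS expn0 muln1 mulnA.
(* As k is positive, each monomial of the time bound is at most k^3 or k^2 l; what remains is linear
   in the monomials. *)
have : k * k <= k * k * k by rewrite leq_pmulr.
have : k <= k * k by rewrite leq_pmulr.
have : k * l <= k * k * l by rewrite -mulnA leq_pmull.
have : l <= k * l by rewrite leq_pmull.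
lia.
Qed.

Lemma maintained_consistent (R : realDomainType) k (sc : centers R k) n (D : demand k
  n) s :
  0 < k -> maintained build_index insert_unit sc D s -> exists A, consistent sc D s A.
Proof.
move=> k_gt0; elim=> {n D s} [n D A t s noneg ex|n D D' s t s' _ [A ok] ext ex].
  by have [t' [s' [/(exec_det ex) <- ok]]] := build_indexP noneg; exists A.
have [//|//|//|//|//|t' [s2 [/(exec_det ex) <- _ ok']]] :=
  insert_unitP (B := insert_bound k n) k_gt0 ext ok.
exact: ok'.
Qed.

Theorem theorem3 :
  exists (build insert : cmd) (C : nat),
    forall (R : realDomainType) (k : nat) (sc : centers R k), 0 < k ->
      (forall (n : nat) (D : demand k n) (A : allotment k n),
         ~ has_negative_loop sc D A ->
         exists (t : nat) (s : state R),
           exec sc D build (initial_state R A) t s /\ holds s A) /\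
      (forall (n : nat) (D : demand k n) (s : state R),
         maintained build insert sc D s ->
         forall D' : demand k n.+1, extends D' D ->
         exists (t : nat) (s' : state R) (A' : allotment k n.+1),
           [/\ exec sc D' insert s t s',
               holds s' A',
               ~ has_negative_loop sc D' A' &
               t <= C * (k ^ 3 + k ^ 2 * trunc_log 2 n)]).
Proof.
exists build_index, insert_unit, (21 * 1000) => R k sc k_gt0; split=> [n D A noneg|n D s].
  by have [t [s [ex [hA _ _ _]]]] := build_indexP noneg; exists t, s.
move=> /(maintained_consistent k_gt0)[A ok] D' ext.
have [//|//|//|//|//|t [s' [ex le_t [A' [hA' _ _ noneg']]]]] :=
  insert_unitP (B := insert_bound k n) k_gt0 ext ok.
by exists t, s', A'; split=> //; apply: leq_trans le_t (insert_time _ k_gt0).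
Qed.
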